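(* Let $G$ be a finite abelian group of odd order $\nu$, let $\delta_\pm=(\nu\pm\sqrt{\nu^2+4})/2$, and let $\mathcal{A}$ be a unital associative $\mathbb{C}$-algebra (not assumed to be a $*$-algebra). Suppose $\alpha_g$ ($g\in G$, with $\alpha_0=\mathrm{id}$) and $\rho$ are unital algebra endomorphisms of $\mathcal{A}$, and $s,s',t_g,t_g'\in\mathcal{A}$ ($g\in G$) are elements with $$s's=1,\quad s't_g=t_g's=0,\quad t_g't_h=\delta_{g,h},\quad ss'+\sum_{g}t_gt_g'=1,$$ such that for all $g,h\in G$, $x\in\mathcal{A}$ $$\alpha_g\circ\alpha_h=\alpha_{g+h},\qquad \alpha_g\circ\rho=\rho\circ\alpha_{-g},\qquad \rho(\rho(x))=sxs'+\sum_{g\in G}t_g\,\alpha_g(\rho(x))\,t_g'.$$ Suppose further that all $\alpha_g$ and $\alpha_g\rho:=\alpha_g\circ\rho$ are simple (in the sense given in the context). Then, after rescaling $s,t_g$ by suitable nonzero complex numbers and $s',t_g'$ by the inverse numbers, there are a choice of sign $\pm$, a complex number $\omega$ with $\omega^3=1$, a square root $b$ of $1/(\omega\delta_\pm)$, and numbers $A_{g,h}\in\mathbb{C}$ ($g,h\in G$) such that for all $g,h\in G$ $$\rho(s)=\delta_\pm^{-1}s+b\sum_{k}t_kt_k,\qquad \rho(s')=\delta_\pm^{-1}s'+\omega b\sum_{k}t'_kt'_k,$$ $$\rho(t_g)=b\,s\,t'_{-g}+\omega\,t_{-g}ss'+\sum_{l,k}A_{l+g,k+g}\,t_l\,t_{l+k+g}\,t_k',$$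 $$\rho(t_g')=\omega b\,t_{-g}s'+\overline{\omega}\,ss't'_{-g}+\sum_{l,k}A_{k+g,l+g}\,t_k\,t'_{g+l+k}\,t_l',$$ $$\alpha_g(s)=s,\quad \alpha_g(s')=s',\quad \alpha_g(t_h)=t_{h+2g},\quad \alpha_g(t_h')=t'_{h+2g}$$ (all sums over $G$). In particular, $\alpha_g$ and $\rho$ restrict to algebra endomorphisms of the Leavitt algebra $\mathcal{L}_{\nu+1}$ generated by $s,s',t_g,t'_g$. Moreover, for all $g,h,i,k\in G$ the $A_{g,h}$ satisfy $$A_{g,h}=\omega A_{-h,g-h}=\overline{\omega}A_{h-g,-g},$$ $$\sum_{h}A_{h,0}=-\overline{\omega}\,\delta_\pm^{-1},$$ $$\sum_{g}A_{h+g,k}A_{k,g}=\delta_{h,0}-\delta_\pm^{-1}\delta_{k,0},$$ $$\sum_{l,m}A_{l,m}A_{l+g,h}A_{h+m,l+i}A_{i,k+m}=A_{h-g,i-g}\,\delta_{k,g}-\overline{\omega}\,\delta_\pm^{-1}\delta_{h,0}A_{i,k}-\omega\,\delta_\pm^{-1}A_{g,h}\,\delta_{i,0}.$$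
   Context: For algebra endomorphisms $\beta,\gamma$ of $\mathcal{A}$, $\mathrm{Hom}(\beta,\gamma)=\{r\in\mathcal{A}: r\beta(x)=\gamma(x)r\ \ \forall x\in\mathcal{A}\}$ is the space of intertwiners. ''All $\alpha_g$ and $\alpha_g\rho$ are simple'' means: for all $g,h\in G$, $\mathrm{Hom}(\alpha_g\rho,\alpha_h\rho)=\mathrm{Hom}(\alpha_g,\alpha_h)=\mathbb{C}1\,\delta_{g,h}$ (i.e. $\mathbb{C}1$ if $g=h$ and $0$ otherwise) and $\mathrm{Hom}(\alpha_g,\alpha_h\rho)=\mathrm{Hom}(\alpha_g\rho,\alpha_h)=0$. The Leavitt algebra $\mathcal{L}_N$ is the unital associative $\mathbb{C}$-algebra with generators $x_1,\dots,x_N,x_1',\dots,x_N'$ and relations $x_i'x_j=\delta_{i,j}$, $\sum_i x_ix_i'=1$; here the generators are $s,t_g$ and $s',t'_g$ ($g\in G$), so $N=\nu+1$. $\delta_{g,h}$ (two indices) is the Kronecker delta; $\delta_\pm$ is the number $(\nu\pm\sqrt{\nu^2+4})/2$ for the fixed sign. *)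

(* Defs.v *)
From HB Require Import structures.
From mathcomp Require Import all_boot all_order all_algebra.
From mathcomp Require Import complex.
From mathcomp Require Import boolp classical_sets reals.

Set Implicit Arguments.
Unset Strict Implicit.
Unset Printing Implicit Defensive.

Import Order.TTheory GRing.Theory Num.Theory.

Local Open Scope ring_scope.
Local Open Scope complex_scope.
Local Open Scope classical_set_scope.

(* (nu + sqrt (nu^2 + 4)) / 2 for [minus = false] and
   (nu - sqrt (nu^2 + 4)) / 2 for [minus = true]. *)
Definition delta_pm (R : realType) (nu : nat) (minus : bool) : R[i] :=
  ((nu%:R + (-1) ^+ minus * Num.sqrt (nu%:R ^+ 2 + 4)) / 2 : R)%:C.

Definition kdelta (C : pzSemiRingType) (T : eqType) (x y : T) : C :=
  (x == y)%:R.

Section Algebras.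
Variable C : comNzRingType.

Definition Hom (A : algType C) (beta gamma : A -> A) : set A :=
  [set r | forall x, r * beta x = gamma x * r].

Definition scalars (A : algType C) : set A := [set c%:A | c in [set: C]].

Definition all_simple (A : algType C) (G : eqType)
    (alpha : G -> A -> A) (rho : A -> A) : Prop :=
  forall g h : G,
    [/\ Hom (alpha g \o rho) (alpha h \o rho)
          = (if g == h then @scalars A else [set 0]),
        Hom (alpha g) (alpha h) = (if g == h then @scalars A else [set 0]),
        Hom (alpha g) (alpha h \o rho) = [set 0] &
        Hom (alpha g \o rho) (alpha h) = [set 0]].

Definition leavitt_relations (I : finType) (L : algType C) (x x' : I -> L)
    : Prop :=
  (forall i j, x' i * x j = (kdelta C i j)%:A) /\ \sum_i x i * x' i = 1.

(* L, with the elements x i and x' i, is the unital associative algebra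
   presented by these generators and the Leavitt relations; the L_N of the
   literature is the case #|I| = N. *)
Definition is_leavitt (I : finType) (L : algType C) (x x' : I -> L) : Prop :=
  leavitt_relations x x' /\
  forall (B : algType C) (y y' : I -> B), leavitt_relations y y' ->
    exists f : {lrmorphism L -> B},
      (forall i, f (x i) = y i /\ f (x' i) = y' i) /\
      (forall f' : {lrmorphism L -> B},
         (forall i, f' (x i) = y i /\ f' (x' i) = y' i) -> f' =1 f).

(* The unital subalgebra generated by X. *)
Inductive subalg_gen (A : algType C) (X : set A) : set A :=
| subalg_gen_in x : X x -> subalg_gen X x
| subalg_gen_1 : subalg_gen X 1
| subalg_gen_lin c x y :
    subalg_gen X x -> subalg_gen X y -> subalg_gen X (c *: x + y)
| subalg_gen_mul x y :
    subalg_gen X x -> subalg_gen X y -> subalg_gen X (x * y).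

(* The nu + 1 elements s, t_g (g in G) as one family. *)
Definition family_of (A : algType C) (G : Type) (s : A) (t : G -> A)
    (o : option G) : A :=
  if o is Some g then t g else s.

(* The subalgebra generated by s, s', t_g, t'_g is the Leavitt algebra on these
   generators, and alpha_g, rho restrict to algebra endomorphisms of it.  It
   is given as an algebra L embedded in A by iota. *)
Definition restrict_to_leavitt (A : algType C) (G : finType)
    (alpha : G -> A -> A) (rho : A -> A) (s s' : A) (t t' : G -> A) : Prop :=
  exists (L : algType C) (x x' : option G -> L) (iota : {lrmorphism L -> A})
         (alphaL : G -> {lrmorphism L -> L}) (rhoL : {lrmorphism L -> L}),
    [/\ is_leavitt x x',
        injective iota,
        (forall o, iota (x o) = family_of s t o /\
                   iota (x' o) = family_of s' t' o),
        range iota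
          = subalg_gen (range (family_of s t) `|` range (family_of s' t')) &
        (forall g y, iota (alphaL g y) = alpha g (iota y)) /\
        (forall y, iota (rhoL y) = rho (iota y))].

End Algebras.

(* Main.v *)
Require Import Defs.
From HB Require Import structures.
From mathcomp Require Import all_boot all_order all_algebra.
From mathcomp Require Import complex.
From mathcomp Require Import boolp classical_sets reals.
From mathcomp Require Import ring zify.

(* Write rr for the square of rho.  The formula for rr says
     rr(x) s = s x,  s' rr(x) = x s',  rr(x) t_g = t_g alpha_g(rho(x)),
     t'_g rr(x) = alpha_g(rho(x)) t'_g,
   so by simplicity Hom(id, rr), Hom(alpha_g rho, rr) and Hom(rr, alpha_g rho) are the
   lines spanned by s, t_g and t'_g.  Each contraction such as s' rho(s), t'_g rho(s) or
   t'_h rho(t_g) t_l lies in one of these lines or is a scalar, and since alpha_h(t_g) is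
   a multiple of t_{g+2h} with G of odd order, the t_g can be rescaled so that alpha
   permutes them; this leaves finitely many constants a, b, B, C and the matrix M.
   Computing contractions of rr(s) = a rho(s) + b sum_g rho(t_g)^2 in two ways gives
   alpha_h(s) = s, b B C = a, a^2 + #|G| a = 1 and the linear and quadratic relations for
   M.  Applying rho to B t'_{-g} = s' rho(t_g), b t_g = t'_g rho(s) and
   b' t'_g = rho(s') t_g determines rho(t'_g) and gives C^3 = 1 and the symmetry of M;
   contracting rr(t_0) gives the quartic relation.  Rescaling s makes b = B.

   The subalgebra generated by a Leavitt family with at least two letters has the
   universal property because each of its nonzero elements w satisfies u w v = 1 for
   suitable u and v. *)

Set Implicit Arguments.
Unset Strict Implicit.
Unset Printing Implicit Defensive.

Import Order.TTheory GRing.Theory Num.Theory.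

Local Open Scope ring_scope.

Lemma kdelta_alg (F : comNzRingType) (A : algType F) (T : eqType) (x y : T) :
  (kdelta F x y)%:A = (x == y)%:R :> A.
Proof. by rewrite /kdelta scaler_nat. Qed.

(** * Words in a Leavitt family, and compression of a nonzero element to 1 *)

Section LeavittWords.
Variables (F : fieldType) (I : finType) (E : algType F) (z z' : I -> E).
Hypothesis zP : leavitt_relations z z'.

Fixpoint word (u : seq I) : E := if u is i :: v then z i * word v else 1.
(** The letters are multiplied in reverse order, so that [coword u * word v] cancels letter by
    letter from the heads of [u] and [v]. *)
Fixpoint coword (u : seq I) : E := if u is i :: v then coword v * z' i else 1.

Lemma word_cat u v : word (u ++ v) = word u * word v.
Proof. by elim: u => [|i u IH] /=; rewrite ?mul1r // IH mulrA. Qed.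

Lemma coword_cat u v : coword (u ++ v) = coword v * coword u.
Proof. by elim: u => [|i u IH] /=; rewrite ?mulr1 // IH mulrA. Qed.

Lemma leavittE i j : z' i * z j = (i == j)%:R.
Proof. by case: zP => -> _; rewrite kdelta_alg. Qed.

Lemma leavitt_sum : \sum_i z i * z' i = 1.
Proof. by case: zP. Qed.

Lemma word_nseq n i : word (nseq n i) = z i ^+ n.
Proof. by elim: n => [|n IH] /=; rewrite ?expr0 // IH exprS. Qed.

Lemma coword_nseq n i : coword (nseq n i) = z' i ^+ n.
Proof. by elim: n => [|n IH] /=; rewrite ?expr0 // IH exprSr. Qed.

Lemma leavitt_expK i n x : z' i ^+ n * (z i ^+ n * x) = x.
Proof.
elim: n x => [|n IH] x; first by rewrite !expr0 !mul1r.
by rewrite exprSr exprS -!mulrA (mulrA (z' i)) leavittE eqxx mul1r IH.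
Qed.

Lemma coword_word_le u v : (size v <= size u)%N ->
  coword u * word v = 0 \/
  exists2 w, size w = (size u - size v)%N & coword u * word v = coword w.
Proof.
elim: u v => [|i u IH] [|j v] //= le_vu; first by right; exists [::]; rewrite ?mulr1.
  by right; exists (i :: u); rewrite ?subn0 ?mulr1.
rewrite -mulrA (mulrA (z' i)) leavittE.
case: eqP => _; last by left; rewrite mul0r mulr0.
by rewrite mul1r subSS; apply: IH.
Qed.

Lemma coword_word_ge u v : (size u <= size v)%N ->
  coword u * word v = 0 \/
  exists2 w, size w = (size v - size u)%N & coword u * word v = word w.
Proof.
elim: u v => [|i u IH] [|j v] //= le_uv; first by right; exists [::]; rewrite ?mulr1.
  by right; exists (j :: v); rewrite ?subn0 ?mul1r.
rewrite -mulrA (mulrA (z' i)) leavittE.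
case: eqP => _; last by left; rewrite mul0r mulr0.
by rewrite mul1r subSS; apply: IH.
Qed.

Section TwoLetters.
Variables i j : I.
Hypothesis neq_ij : i != j.

(** Compression by [cokiller m] and [killer m] fixes scalars and annihilates words and cowords of
    length between 1 and [m]; it serves to isolate the degree 0 part of an element. *)
Definition killer m := z i ^+ m * z j.
Definition cokiller m := z' j * z' i ^+ m.

Lemma cokillerK m : cokiller m * killer m = 1.
Proof. by rewrite /killer /cokiller -mulrA leavitt_expK leavittE eqxx. Qed.

(** Unless the product already vanishes, [u] is a power of the letter [i]; cancelling powers of
    [z i] then leaves [z' j] in front of a positive power of [z i]. *)
Lemma kill_word m u : (0 < size u <= m)%N -> cokiller m * word u * killer m = 0.
Proof.
case/andP=> u_gt0 le_um; rewrite /cokiller -(mulrA (z' j)).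
have: z' i ^+ m * word u = 0 \/ z' i ^+ m * word u = z' i ^+ (m - size u).
  move: le_um {u_gt0}; elim: u m => [|k u IH] [|m] //=;
    try by move=> _; right; rewrite mulr1.
  rewrite ltnS => le_um; rewrite exprSr -mulrA (mulrA (z' i)) leavittE.
  case: eqP => _; last by left; rewrite mul0r mulr0.
  by rewrite mul1r subSS; apply: IH.
case=> ->; first by rewrite mulr0 mul0r.
have {1}-> : killer m = z i ^+ (m - size u) * (z i ^+ size u * z j).
  by rewrite mulrA -exprD subnK.
rewrite -mulrA leavitt_expK.
case: (size u) u_gt0 => // n _.
by rewrite exprS !mulrA leavittE eq_sym (negPf neq_ij) !mul0r.
Qed.

Lemma kill_coword m u :
  (0 < size u <= m)%N -> cokiller m * coword u * killer m = 0.
Proof.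
case/andP=> u_gt0 le_um; rewrite /killer -mulrA (mulrA (coword u)).
have: coword u * z i ^+ m = 0 \/ coword u * z i ^+ m = z i ^+ (m - size u).
  move: le_um {u_gt0}; elim: u m => [|k u IH] [|m] //=;
    try by move=> _; right; rewrite mul1r.
  rewrite ltnS => le_um; rewrite exprS -mulrA (mulrA (z' k)) leavittE.
  case: eqP => _; last by left; rewrite mul0r mulr0.
  by rewrite mul1r subSS; apply: IH.
case=> ->; first by rewrite mul0r mulr0.
have -> : cokiller m = z' j * z' i ^+ size u * z' i ^+ (m - size u).
  by rewrite -mulrA -exprD subnKC.
rewrite -mulrA leavitt_expK.
by case: (size u) u_gt0 => // n _; rewrite exprSr -!mulrA leavittE (negPf neq_ij) !mulr0.
Qed.

End TwoLetters.

Definition monomial (p : F * seq I * seq I) : E :=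
  p.1.1 *: (word p.1.2 * coword p.2).

Definition eval (ps : seq (F * seq I * seq I)) : E := \sum_(p <- ps) monomial p.

Lemma monomialM p q : exists r, monomial p * monomial q = monomial r.
Proof.
case: p q => [[c u] v] [[d u'] v'].
rewrite /monomial /= -scalerAl -scalerAr scalerA.
have -> : word u * coword v * (word u' * coword v')
  = word u * (coword v * word u') * coword v' by rewrite !mulrA.
have zero : coword v * word u' = 0 -> exists r,
    (c * d) *: (word u * (coword v * word u') * coword v') = monomial r.
  by move=> ->; exists (0, [::], [::]); rewrite /monomial /= mulr0 mul0r scaler0 scale0r.
have [le_uv|/ltnW le_vu] := leqP (size u') (size v).
  case: (coword_word_le le_uv) => [/zero //|[w _ ->]].
  by exists (c * d, u, v' ++ w); rewrite /monomial /= coword_cat mulrA.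
case: (coword_word_ge le_vu) => [/zero //|[w _ ->]].
by exists (c * d, u ++ w, v'); rewrite /monomial /= word_cat.
Qed.

(** The span of the monomials contains the generators and is closed under products by
    [monomialM]. *)
Lemma subalg_gen_eval x : subalg_gen (range z `|` range z')%classic x ->
  exists ps, x = eval ps.
Proof.
elim=> {x} [_ [[i _ <-]|[i _ <-]]| |c x y _ [ps ->] _ [qs ->]|x y _ [ps ->] _ [qs ->]].
- exists [:: (1, [:: i], [::])].
  by rewrite /eval big_seq1 /monomial /= !mulr1 scale1r.
- exists [:: (1, [::], [:: i])].
  by rewrite /eval big_seq1 /monomial /= !mul1r scale1r.
- by exists [:: (1, [::], [::])]; rewrite /eval big_seq1 /monomial /= mul1r scale1r.
- exists ([seq (c * p.1.1, p.1.2, p.2) | p <- ps] ++ qs).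
  rewrite /eval big_cat big_map scaler_sumr /=; congr (_ + _).
  by apply: eq_bigr => p _; rewrite /monomial /= scalerA.
- rewrite /eval; elim: ps => [|p ps [rs IH]].
    by exists [::]; rewrite !big_nil mul0r.
  have [rs' IH'] : exists rs, monomial p * (\sum_(q <- qs) monomial q) = eval rs.
    elim: (qs) => [|q qs' [ts IHq]].
      by exists [::]; rewrite /eval !big_nil mulr0.
    have [r Er] := monomialM p q.
    by exists (r :: ts); rewrite /eval !big_cons mulrDr IHq Er.
  exists (rs' ++ rs).
  by rewrite big_cons mulrDl IH IH' /eval big_cat.
Qed.

Lemma leavitt_eq0l x : (forall i, z' i * x = 0) -> x = 0.
Proof.
move=> x0; rewrite -[x]mul1r -leavitt_sum mulr_suml big1 // => i _.
by rewrite -mulrA x0 mulr0.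
Qed.

Lemma leavitt_eq0r x : (forall i, x * z i = 0) -> x = 0.
Proof.
move=> x0; rewrite -[x]mulr1 -leavitt_sum mulr_sumr big1 // => i _.
by rewrite mulrA x0 mul0r.
Qed.

Lemma leavitt_neq0l m x : x != 0 -> exists2 u, size u = m & coword u * x != 0.
Proof.
elim: m x => [|m IH] x x0; first by exists [::]; rewrite //= mul1r.
have [i ix0] : exists i, z' i * x != 0.
  apply: contrapT => nx; move/eqP: x0; apply; apply: leavitt_eq0l => i.
  by apply: contrapT => /eqP ix; apply: nx; exists i.
have [u su ux] := IH _ ix0.
by exists (i :: u); rewrite /= ?su // -mulrA.
Qed.

Lemma leavitt_neq0r m x : x != 0 -> exists2 u, size u = m & x * word u != 0.
Proof.
elim: m x => [|m IH] x x0; first by exists [::]; rewrite //= mulr1.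
have [i ix0] : exists i, x * z i != 0.
  apply: contrapT => nx; move/eqP: x0; apply; apply: leavitt_eq0r => i.
  by apply: contrapT => /eqP ix; apply: nx; exists i.
have [u su ux] := IH _ ix0.
by exists (i :: u); rewrite /= ?su // mulrA.
Qed.

Definition bounded m (p : F * seq I * seq I) :=
  ((size p.1.2 <= m) && (size p.2 <= m))%N.

(** Degree 0 for the grading in which [z i] has degree 1 and [z' i] has degree -1. *)
Definition balanced (p : F * seq I * seq I) := size p.1.2 == size p.2.

(** Since [u] and [v] are at least as long as the words of [p], the two outer contractions leave a
    coword times a word; balance makes their lengths equal, so these contract to a scalar too. *)
Lemma balanced_scalar m u v p : bounded m p -> size u = m -> size v = m ->
  balanced p -> exists c, coword u * monomial p * word v = c%:A.
Proof.
case: p => [[c a] b] /= /andP[/= am bm] su sv /eqP /= sab.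
rewrite /monomial /= -(scalerAr _ (coword u)) -scalerAl.
have -> : coword u * (word a * coword b) * word v
  = (coword u * word a) * (coword b * word v) by rewrite !mulrA.
have [|->|[w sw ->]] := @coword_word_le u a; first by rewrite su.
  by exists 0; rewrite mul0r scaler0 scale0r.
have [|->|[w' sw' ->]] := @coword_word_ge b v; first by rewrite sv.
  by exists 0; rewrite mulr0 scaler0 scale0r.
have [|->|[w2 sw2 ->]] := @coword_word_le w w'; first by rewrite sw sw' su sv sab.
  by exists 0; rewrite scaler0 scale0r.
by case: w2 sw2 => [|? ?] /=; rewrite sw sw' su sv sab subnn // => _; exists c.
Qed.

(** Here the lengths of the remaining coword and word differ, so a word or coword of length between
    1 and [m] is left, and compression annihilates it. *)
Lemma unbalanced_killed i j m u v p : i != j -> bounded m p ->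
  size u = m -> size v = m -> ~~ balanced p ->
  cokiller i j m * (coword u * monomial p * word v) * killer i j m = 0.
Proof.
case: p => [[c a] b] /= ij /andP[/= am bm] su sv sab.
have {sab}sab : size a != size b by [].
rewrite /monomial /= -(scalerAr _ (coword u)) -scalerAl.
have -> : coword u * (word a * coword b) * word v
  = (coword u * word a) * (coword b * word v) by rewrite !mulrA.
have [|->|[w sw ->]] := @coword_word_le u a; first by rewrite su.
  by rewrite mul0r scaler0 mulr0 mul0r.
have [|->|[w' sw' ->]] := @coword_word_ge b v; first by rewrite sv.
  by rewrite mulr0 scaler0 mulr0 mul0r.
rewrite -scalerAr -scalerAl.
have [le_w|/ltnW le_w] := leqP (size w') (size w).
  have [|->|[w2 sw2 ->]] := @coword_word_le w w' => //.
    by rewrite mulr0 mul0r scaler0.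
  by rewrite kill_coword ?scaler0 //; lia.
have [|->|[w2 sw2 ->]] := @coword_word_ge w w' => //.
  by rewrite mulr0 mul0r scaler0.
by rewrite kill_word ?scaler0 //; lia.
Qed.

(** Choose [u] and [v] of length [m] with nonzero contraction of the balanced part; it is then a
    nonzero scalar, and the killers remove all the other terms. *)
Lemma eval_balanced_invertible (i j : I) m ps : i != j -> all (bounded m) ps ->
  eval [seq p <- ps | balanced p] != 0 -> exists u v, u * eval ps * v = 1.
Proof.
move=> ij /allP bps nz.
have [u su {}nz] := leavitt_neq0l m nz.
have [v sv {}nz] := leavitt_neq0r m nz.
have [c Ec] : exists c, coword u * eval [seq p <- ps | balanced p] * word v = c%:A.
  rewrite /eval big_filter mulr_sumr mulr_suml.
  elim: ps bps {nz} => [|p ps IH] bps; first by exists 0; rewrite big_nil scale0r.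
  have [|c Ec] := IH; first by move=> q qps; rewrite bps // inE qps orbT.
  rewrite big_cons; case: ifP => bp; last by exists c.
  have [|d ->] := balanced_scalar _ su sv bp; first by rewrite bps ?mem_head.
  by exists (d + c); rewrite Ec scalerDl.
have c0 : c != 0 by apply: contraNneq nz => c0; rewrite Ec c0 scale0r.
exists (c^-1 *: (cokiller i j m * coword u)), (word v * killer i j m).
have split_eval : eval ps = eval [seq p <- ps | balanced p]
    + eval [seq p <- ps | ~~ balanced p].
  by rewrite /eval !big_filter [LHS](bigID balanced).
rewrite -!scalerAl.
have -> : cokiller i j m * coword u * eval ps * (word v * killer i j m)
  = cokiller i j m * (coword u * eval ps * word v) * killer i j m.
  by rewrite !mulrA.
rewrite split_eval mulrDr mulrDl Ec mulrDr mulrDl.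
have -> : cokiller i j m * (coword u * eval [seq p <- ps | ~~ balanced p] * word v)
          * killer i j m = 0.
  rewrite /eval big_filter big_seq_cond mulr_sumr !mulr_suml mulr_sumr mulr_suml.
  by apply: big1 => p /andP[pps bp]; apply: unbalanced_killed => //; apply: bps.
by rewrite addr0 -scalerAr mulr1 -scalerAl cokillerK scalerA mulVf // scale1r.
Qed.

(* Some homogeneous component of x is nonzero; multiplying x by powers of one
   generator moves that component to degree 0. *)
Lemma subalg_gen_invertible (i j : I) x : i != j ->
  subalg_gen (range z `|` range z')%classic x -> x != 0 ->
  exists u v, u * x * v = 1.
Proof.
move=> ij /subalg_gen_eval[ps ->] nz.
have [n bps] : exists n, all (bounded n) ps.
  elim: (ps) => [|p qs [n bn]]; first by exists 0%N.
  exists (maxn n (maxn (size p.1.2) (size p.2))); apply/andP; split.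
    by rewrite /bounded; lia.
  by apply: sub_all bn => q; rewrite /bounded; lia.
(* The offset [n] keeps the truncated subtraction exact: all lengths are at most [n], so the degrees
   run from 0 to 2n. *)
pose deg (p : F * seq I * seq I) := (n + size p.1.2 - size p.2)%N.
have [d nzd] : exists d, eval [seq p <- ps | deg p == d] != 0.
  apply: contrapT => nd; move/eqP: nz; apply.
  transitivity (\sum_(d < (n + n).+1) eval [seq p <- ps | deg p == d]).
    under [RHS]eq_bigr do rewrite /eval big_filter.
    rewrite (exchange_big_dep xpredT) //= /eval big_seq [RHS]big_seq.
    apply: eq_bigr => p /(allP bps) /andP[bp _].
    have lt_d : (deg p < (n + n).+1)%N by rewrite /deg; lia.
    by rewrite (big_pred1 (Ordinal lt_d)) // => d; rewrite eq_sym.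
  by apply: big1 => d _; apply: contrapT => /eqP nz; apply: nd; exists (d : nat).
(* On lists this is multiplication by [z i ^+ n] on the left and [z' i ^+ d] on the right; it makes
   balanced exactly the monomials with [deg p == d]. *)
pose shift (p : F * seq I * seq I) :=
  (p.1.1, nseq n i ++ p.1.2, nseq d i ++ p.2).
have eval_shift qs : eval (map shift qs) = z i ^+ n * eval qs * z' i ^+ d.
  rewrite /eval big_map mulr_sumr mulr_suml; apply: eq_bigr => p _.
  rewrite /monomial /= word_cat coword_cat word_nseq coword_nseq.
  by rewrite -scalerAr -scalerAl !mulrA.
have [] := @eval_balanced_invertible i j (n + n + d) (map shift ps) ij.
- rewrite all_map; apply: sub_all bps => p.
  by rewrite /bounded /= !size_cat !size_nseq; lia.
- rewrite filter_map -(eq_in_filter (a1 := fun p => deg p == d)); last first.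
    move=> p /(allP bps) /andP[bp bp']; rewrite /balanced /= !size_cat !size_nseq.
    by rewrite /deg; lia.
  rewrite eval_shift; apply: contraNneq nzd.
  move/(congr1 (fun x => z' i ^+ n * x * z i ^+ d)).
  rewrite mulr0 mul0r -(mulrA (z i ^+ n)) leavitt_expK -mulrA.
  by rewrite -[z i ^+ d]mulr1 leavitt_expK mulr1 => ->.
move=> u [v]; rewrite eval_shift => uv.
by exists (u * z i ^+ n), (z' i ^+ d * v); rewrite -uv !mulrA.
Qed.

End LeavittWords.

(** * The generated subalgebra as an algebra type, and its universal property *)

Section SubalgebraType.
Variables (F : comNzRingType) (A : algType F) (X : set A).

Definition in_subalg : {pred A} := fun x => `[< subalg_gen X x >].

Lemma in_subalgP x : reflect (subalg_gen X x) (x \in in_subalg).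
Proof. exact: asboolP. Qed.

Lemma subalg_gen_0 : subalg_gen X 0.
Proof.
by rewrite -[0](addNr 1) -scaleN1r; apply: subalg_gen_lin; apply: subalg_gen_1.
Qed.

Lemma subalg_gen_scale c x : subalg_gen X x -> subalg_gen X (c *: x).
Proof.
by move=> Xx; rewrite -[_ *: _]addr0; apply: subalg_gen_lin => //; apply: subalg_gen_0.
Qed.

Lemma subalg_gen_add x y : subalg_gen X x -> subalg_gen X y -> subalg_gen X (x + y).
Proof. by move=> Xx Xy; rewrite -[x]scale1r; apply: subalg_gen_lin. Qed.

Lemma subalg_gen_sum (J : finType) (f : J -> A) :
  (forall j, subalg_gen X (f j)) -> subalg_gen X (\sum_j f j).
Proof.
by move=> Xf; elim/big_rec: _ => [|j x _]; [apply: subalg_gen_0 | apply: subalg_gen_add].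
Qed.

Lemma in_subalg_closed : GRing.subsemialg_closed in_subalg.
Proof.
split; first by apply/in_subalgP/subalg_gen_1.
- by split=> [|x y /in_subalgP Xx /in_subalgP Xy]; apply/in_subalgP;
    [apply: subalg_gen_0 | apply: subalg_gen_add].
- by move=> c x /in_subalgP Xx; apply/in_subalgP/subalg_gen_scale.
- by move=> x y /in_subalgP Xx /in_subalgP Xy; apply/in_subalgP/subalg_gen_mul.
Qed.

Record subalg := Subalg { subalg_val :> A; _ : subalg_val \in in_subalg }.

HB.instance Definition _ := [isSub for subalg_val].
HB.instance Definition _ := [Choice of subalg by <:].
HB.instance Definition _ :=
  GRing.SubChoice_isSubAlgebra.Build F A in_subalg subalg in_subalg_closed.

Lemma subalg_valP (u : subalg) : subalg_gen X (val u).
Proof. exact/in_subalgP/valP. Qed.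

Definition subalg_in x (Xx : subalg_gen X x) : subalg := Subalg (introT (in_subalgP x) Xx).

End SubalgebraType.

Lemma lrmorphism_of (F : comNzRingType) (L B : algType F) (f : L -> B) :
  linear f -> f 1 = 1 -> {morph f : x y / x * y} ->
  exists g : {lrmorphism L -> B}, g =1 f.
Proof.
move=> f_lin f1 fM.
pose lin := GRing.isLinear.Build F L B *:%R f f_lin.
pose mul := GRing.isMonoidMorphism.Build L B f (f1, fM).
pose g : {lrmorphism L -> B} := HB.pack f lin mul.
by exists g.
Qed.

Lemma subalg_restriction (F : comNzRingType) (A : algType F) (X : set A)
    (f : {lrmorphism A -> A}) :
  (forall x, X x -> subalg_gen X (f x)) ->
  exists fX : {lrmorphism subalg X -> subalg X}, forall u, val (fX u) = f (val u).
Proof.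
move=> fX; have fS x : subalg_gen X x -> subalg_gen X (f x).
  elim=> {x} [x /fX //||c x y _ Xx _ Xy|x y _ Xx _ Xy].
  - by rewrite rmorph1; apply: subalg_gen_1.
  - by rewrite linearP; apply: subalg_gen_lin.
  - by rewrite rmorphM; apply: subalg_gen_mul.
pose g u := subalg_in (fS _ (subalg_valP u)).
have [|||h hE] := @lrmorphism_of F (subalg X) (subalg X) g.
- by move=> c u v; apply: val_inj; rewrite /= !linearP.
- by apply: val_inj; rewrite /= rmorph1.
- by move=> u v; apply: val_inj; rewrite /= !rmorphM.
by exists h => u; rewrite hE.
Qed.

(** This is the totality of the graph from which the morphism in [subalg_is_leavitt] is built. *)
Lemma pair_subalg_gen (F : comNzRingType) (I : finType) (A B : algType F)
    (x x' : I -> A) (y y' : I -> B) a :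
  subalg_gen (range x `|` range x')%classic a ->
  exists b, subalg_gen
    (range (fun i => (x i, y i)) `|` range (fun i => (x' i, y' i)))%classic (a, b).
Proof.
elim=> {a} [_ [[i _ <-]|[i _ <-]]||c a a' _ [b Xb] _ [b' Xb']|a a' _ [b Xb] _ [b' Xb']].
- by exists (y i); apply: subalg_gen_in; left; exists i.
- by exists (y' i); apply: subalg_gen_in; right; exists i.
- by exists 1; apply: subalg_gen_1.
- by exists (c *: b + b'); apply: (subalg_gen_lin c Xb Xb').
- by exists (b * b'); apply: (subalg_gen_mul Xb Xb').
Qed.

Lemma pair_leavitt (F : fieldType) (I : finType) (A B : algType F)
    (x x' : I -> A) (y y' : I -> B) :
  leavitt_relations x x' -> leavitt_relations y y' ->
  leavitt_relations (fun i => (x i, y i)) (fun i => (x' i, y' i)).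
Proof.
move=> [xE x1] [yE y1]; split=> [i j|].
  by rewrite [LHS]surjective_pairing /= xE yE.
rewrite [LHS]surjective_pairing (big_morph fst (id1 := 0) (op1 := +%R)) //.
by rewrite (big_morph snd (id1 := 0) (op1 := +%R)) //= x1 y1.
Qed.

(* The subalgebra of A * B generated by the pairs of generators is the graph of
   the required morphism: an element (0, b) with b <> 0 would, by
   subalg_gen_invertible, give 0 = 1 in A. *)
Lemma subalg_is_leavitt (F : fieldType) (I : finType) (A : algType F)
    (x x' : I -> A) (i0 j0 : I) : i0 != j0 -> leavitt_relations x x' ->
  exists (X X' : I -> subalg (range x `|` range x')%classic),
    [/\ is_leavitt X X', forall i, val (X i) = x i & forall i, val (X' i) = x' i].
Proof.
move=> ij xP; set L := subalg _.
have xL i : subalg_gen (range x `|` range x')%classic (x i).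
  by apply: subalg_gen_in; left; exists i.
have x'L i : subalg_gen (range x `|` range x')%classic (x' i).
  by apply: subalg_gen_in; right; exists i.
exists (fun i => subalg_in (xL i)), (fun i => subalg_in (x'L i)).
split=> //; split.
  case: xP => xE x1; split=> [i j|]; apply: val_inj; first by rewrite /= xE.
  by rewrite raddf_sum -[RHS]x1.
move=> B y y' yP.
pose Gr := subalg_gen
  (range (fun i => (x i, y i)) `|` range (fun i => (x' i, y' i)))%classic.
have Gr_fun a b b' : Gr (a, b) -> Gr (a, b') -> b = b'.
  move=> Gb Gb'; apply/eqP; rewrite -subr_eq0; apply/negPn/negP => nz.
  have G0 : Gr (0, b - b').
    have := subalg_gen_lin (-1) Gb' Gb; rewrite !scaleN1r.
    by have -> : - (a, b') + (a, b) = (0, b - b') by congr pair; rewrite /= addrC ?subrr.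
  have [|u [v uv]] := subalg_gen_invertible (pair_leavitt xP yP) ij G0.
    by apply: contraNneq nz => -[->].
  have := congr1 fst uv; rewrite /= mulr0 mul0r => /eqP.
  by rewrite eq_sym oner_eq0.
have Gr_ex (u : L) : exists b, Gr (val u, b).
  exact: pair_subalg_gen (subalg_valP u).
have [f fP] := choice Gr_ex.
have fE a b (u : L) : Gr (a, b) -> val u = a -> f u = b.
  by move=> Gab ua; apply: (@Gr_fun a) => //; rewrite -ua.
have f_lin c u v : f (c *: u + v) = c *: f u + f v.
  exact: fE (subalg_gen_lin c (fP u) (fP v)) _.
have f1 : f 1 = 1 by exact: fE (subalg_gen_1 _) _.
have fM u v : f (u * v) = f u * f v by exact: fE (subalg_gen_mul (fP u) (fP v)) _.
have [h hE] := @lrmorphism_of F L B f f_lin f1 fM.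
exists h; split=> [i|h' h'E].
  by split; rewrite hE; apply: fE => //; apply: subalg_gen_in;
    [left | right]; exists i.
(* Uniqueness, by induction on the generation of [a]; an element of the subtype is determined by its
   value, so [u] may be any lift of [a]. *)
have key a : subalg_gen (range x `|` range x')%classic a ->
    forall u : L, val u = a -> h' u = f u.
  elim=> {a} [_ [[i _ <-]|[i _ <-]] u ua||c a a' Xa IH Xa' IH' u ua
             |a a' Xa IH Xa' IH' u ua].
  - have -> : u = subalg_in (xL i) by apply: val_inj.
    by rewrite (h'E i).1; apply/esym/fE => //; apply: subalg_gen_in; left; exists i.
  - have -> : u = subalg_in (x'L i) by apply: val_inj.
    by rewrite (h'E i).2; apply/esym/fE => //; apply: subalg_gen_in; right; exists i.
  - move=> u u1; have -> : u = 1 by apply: val_inj.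
    by rewrite rmorph1 f1.
  - have -> : u = c *: subalg_in Xa + subalg_in Xa' by apply: val_inj.
    by rewrite f_lin -(IH (subalg_in Xa)) // -(IH' (subalg_in Xa')) // -linearP.
  - have -> : u = subalg_in Xa * subalg_in Xa' by apply: val_inj.
    by rewrite fM -(IH (subalg_in Xa)) // -(IH' (subalg_in Xa')) // -rmorphM.
by move=> u; rewrite hE; apply: key (subalg_valP u) _ _.
Qed.

(** An endomorphism preserves the subalgebra once it sends the generators into it. The element [g0]
    provides [Some g0], a second letter besides [None]. *)
Lemma restrict_to_leavitt_subalg (F : fieldType) (A : algType F) (G : finType)
    (alpha : G -> {lrmorphism A -> A}) (rho : {lrmorphism A -> A})
    (s s' : A) (t t' : G -> A) (g0 : G) :
  leavitt_relations (family_of s t) (family_of s' t') ->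
  (forall g o, subalg_gen (range (family_of s t) `|` range (family_of s' t'))%classic
                 (alpha g (family_of s t o))) ->
  (forall g o, subalg_gen (range (family_of s t) `|` range (family_of s' t'))%classic
                 (alpha g (family_of s' t' o))) ->
  (forall o, subalg_gen (range (family_of s t) `|` range (family_of s' t'))%classic
                 (rho (family_of s t o))) ->
  (forall o, subalg_gen (range (family_of s t) `|` range (family_of s' t'))%classic
                 (rho (family_of s' t' o))) ->
  restrict_to_leavitt (fun g => alpha g : A -> A) rho s s' t t'.
Proof.
move=> rel al al' rh rh'; set X := (_ `|` _)%classic in al al' rh rh'.
have [x [x' [xP xE x'E]]] := @subalg_is_leavitt F _ A _ _ None (Some g0) isT rel.
have alX g : exists h : {lrmorphism subalg X -> subalg X},
    forall u, val (h u) = alpha g (val u).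
  by apply: subalg_restriction => _ [[o _ <-]|[o _ <-]].
have [alphaL alphaLE] := choice alX.
have [|rhoL rhoLE] := @subalg_restriction F A X rho.
  by move=> _ [[o _ <-]|[o _ <-]].
have [|||iota iotaE] := @lrmorphism_of F (subalg X) A val; rewrite //=.
exists (subalg X), x, x', iota, alphaL, rhoL; split=> //.
- by move=> u v; rewrite !iotaE; apply: val_inj.
- by move=> o; rewrite !iotaE.
- apply/seteqP; split=> [_ [u _ <-]|a Xa]; first by rewrite iotaE; apply: subalg_valP.
  by exists (subalg_in Xa); rewrite ?iotaE.
- by split=> [g|] u; rewrite !iotaE.
Qed.

(** * Computation in abelian groups, and halving in odd order *)

Ltac zmod_pull v S :=
  match S with
  | v => constr:(esym (add0r v))
  | (?S1 + v)%R => constr:(erefl S)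
  | (?S1 + ?w)%R =>
      let p := zmod_pull v S1 in
      constr:(etrans (congr1 (fun z => z + w)%R p) (addrAC _ v w))
  end.

Ltac zmod_pullN u S :=
  match S with
  | (- u)%R => constr:(esym (add0r S))
  | (?S1 + - u)%R => constr:(erefl S)
  | (?S1 + ?w)%R =>
      let p := zmod_pullN u S1 in
      constr:(etrans (congr1 (fun z => z + w)%R p) (addrAC _ _ w))
  end.

(* Decides equations in a commutative group by cancelling opposite terms. *)
Ltac zmod :=
  apply: subr0_eq; rewrite ?(mulr2n, opprD, opprK, oppr0, addr0, add0r, addrA);
  repeat match goal with
  | |- (?S + - ?u)%R = _ => let p := zmod_pull u S in
      rewrite (etrans (congr1 (fun z => z - u)%R p) (addrK u _)) ?add0r
  | |- (?S + ?u)%R = _ => let p := zmod_pullN u S in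
      rewrite (etrans (congr1 (fun z => z + u)%R p) (addrNK u _)) ?add0r
  end; try reflexivity.

Section Half.
Variable G : finZmodType.

(** Translation by [g] permutes the terms of the sum over [G] and also adds [g *+ #|G|] to it. *)
Lemma mulrn_card (g : G) : g *+ #|G| = 0.
Proof.
apply: (@addrI _ (\sum_(x : G) x)); rewrite addr0 [RHS](reindex_inj (addIr g)) /=.
by rewrite big_split /= sumr_const.
Qed.

(** For odd order the multiplier is (|G| + 1) / 2, an inverse of 2 modulo |G|. *)
Definition halve (g : G) : G := g *+ uphalf #|G|.

Lemma halveK g : odd #|G| -> halve g *+ 2 = g.
Proof.
move=> oG; rewrite /halve -mulrnA muln2 -[X in g *+ X]/(uphalf #|G|).*2.
have -> : (uphalf #|G|).*2 = #|G|.+1 by rewrite uphalfE -[RHS]odd_double_half /= oG.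
by rewrite mulrS mulrn_card addr0.
Qed.
End Half.

(** * Fusion systems, their one-dimensional intertwiner spaces, and contractions *)

Record fusion_system (F : fieldType) (G : finZmodType) (A : algType F)
    (alpha : G -> {lrmorphism A -> A}) (rho : {lrmorphism A -> A})
    (s s' : A) (t t' : G -> A) : Prop := FusionSystem {
  fs_alpha0 : forall x, alpha 0 x = x;
  fs_s's : s' * s = 1;
  fs_s't : forall g, s' * t g = 0;
  fs_t's : forall g, t' g * s = 0;
  fs_t't : forall g h, t' g * t h = (g == h)%:R;
  fs_sum1 : s * s' + \sum_g t g * t' g = 1;
  fs_alphaD : forall g h x, alpha g (alpha h x) = alpha (g + h) x;
  fs_alpha_rho : forall g x, alpha g (rho x) = rho (alpha (- g) x);
  fs_rho_rho : forall x,
    rho (rho x) = s * x * s' + \sum_g t g * alpha g (rho x) * t' g;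
  fs_hom_rho : forall g h r,
    (forall x, r * alpha g (rho x) = alpha h (rho x) * r) ->
    exists c, r = (c *+ (g == h))%:A;
  fs_hom_alpha : forall g h r, (forall x, r * alpha g x = alpha h x * r) ->
    exists c, r = (c *+ (g == h))%:A;
  fs_hom_alpha_rho : forall g h r,
    (forall x, r * alpha g x = alpha h (rho x) * r) -> r = 0;
  fs_hom_rho_alpha : forall g h r,
    (forall x, r * alpha g (rho x) = alpha h x * r) -> r = 0
}.

(** The coefficient [c *+ (g == h)] merges the two cases of simplicity; this is the form used in
    [fusion_system]. *)
Lemma all_simple_hom (F : fieldType) (G : finZmodType) (A : algType F)
    (alpha : G -> {lrmorphism A -> A}) (rho : {lrmorphism A -> A}) :
  all_simple (fun g => alpha g : A -> A) rho -> forall g h,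
  [/\ forall r, (forall x, r * alpha g (rho x) = alpha h (rho x) * r) ->
        exists c, r = (c *+ (g == h))%:A,
      forall r, (forall x, r * alpha g x = alpha h x * r) ->
        exists c, r = (c *+ (g == h))%:A,
      forall r, (forall x, r * alpha g x = alpha h (rho x) * r) -> r = 0 &
      forall r, (forall x, r * alpha g (rho x) = alpha h x * r) -> r = 0].
Proof.
move=> simple g h; case: (simple g h) => Hrr Haa Har Hra.
have ifP' (r : A) : (if g == h then @scalars _ A else [set 0])%classic r ->
    exists c, r = (c *+ (g == h))%:A.
  by case: eqP => _ => [[c _ <-]|->]; [exists c | exists 0; rewrite scale0r].
split=> r rP.
- by apply: ifP'; rewrite -Hrr.
- by apply: ifP'; rewrite -Haa.
- by have : Defs.Hom (alpha g) (alpha h \o rho) r by []; rewrite Har.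
- by have : Defs.Hom (alpha g \o rho) (alpha h) r by []; rewrite Hra.
Qed.

Section Intertwiners.
Variables (F : fieldType) (G : finZmodType) (A : algType F).
Variables (alpha : G -> {lrmorphism A -> A}) (rho : {lrmorphism A -> A}).
Variables (s s' : A) (t t' : G -> A).
Hypothesis sys : fusion_system alpha rho s s' t t'.

Let alpha0 := fs_alpha0 sys.
Let s's := fs_s's sys.
Let s't := fs_s't sys.
Let t's := fs_t's sys.
Let t't := fs_t't sys.
Let sum1 := fs_sum1 sys.
Let alphaD := fs_alphaD sys.
Let alpha_rho := fs_alpha_rho sys.
Let rho_rho := fs_rho_rho sys.

Let alphaM g x y : alpha g (x * y) = alpha g x * alpha g y.
Proof. exact: rmorphM. Qed.
Let rhoM x y : rho (x * y) = rho x * rho y.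
Proof. exact: rmorphM. Qed.

Lemma fs_t't1 g : t' g * t g = 1. Proof. by rewrite t't eqxx. Qed.

Lemma fs_leftE x : x = s * (s' * x) + \sum_g t g * (t' g * x).
Proof.
rewrite -{1}[x]mul1r -sum1 mulrDl mulr_suml mulrA; congr (_ + _).
by apply: eq_bigr => g _; rewrite mulrA.
Qed.

Lemma fs_rightE x : x = x * s * s' + \sum_g x * t g * t' g.
Proof.
rewrite -{1}[x]mulr1 -sum1 mulrDr mulr_sumr mulrA; congr (_ + _).
by apply: eq_bigr => g _; rewrite mulrA.
Qed.

Lemma fs_eql x y : s' * x = s' * y -> (forall g, t' g * x = t' g * y) -> x = y.
Proof.
move=> Es Et; rewrite [LHS]fs_leftE [RHS]fs_leftE Es; congr (_ + _).
by apply: eq_bigr => g _; rewrite Et.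
Qed.

Lemma fs_eqr x y : x * s = y * s -> (forall g, x * t g = y * t g) -> x = y.
Proof.
move=> Es Et; rewrite [LHS]fs_rightE [RHS]fs_rightE Es; congr (_ + _).
by apply: eq_bigr => g _; rewrite Et.
Qed.

Lemma fs_sum_t' g (f : G -> A) : t' g * (\sum_h t h * f h) = f g.
Proof.
rewrite mulr_sumr (bigD1 g) //= mulrA fs_t't1 mul1r big1 ?addr0 // => h ne.
by rewrite mulrA t't eq_sym (negPf ne) mul0r.
Qed.

Lemma fs_sum_t g (f : G -> A) : (\sum_h f h * t' h) * t g = f g.
Proof.
rewrite mulr_suml (bigD1 g) //= -mulrA fs_t't1 mulr1 big1 ?addr0 // => h ne.
by rewrite -mulrA t't (negPf ne) mulr0.
Qed.

Lemma fs_sum_s' (f : G -> A) : s' * (\sum_h t h * f h) = 0.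
Proof. by rewrite mulr_sumr big1 // => h _; rewrite mulrA s't mul0r. Qed.

Lemma fs_sum_s (f : G -> A) : (\sum_h f h * t' h) * s = 0.
Proof. by rewrite mulr_suml big1 // => h _; rewrite -mulrA t's mulr0. Qed.

Lemma rho_rho_s x : rho (rho x) * s = s * x.
Proof. by rewrite rho_rho mulrDl fs_sum_s addr0 -mulrA s's mulr1. Qed.

Lemma s'_rho_rho x : s' * rho (rho x) = x * s'.
Proof.
rewrite rho_rho mulrDr; under eq_bigr do rewrite -mulrA.
by rewrite fs_sum_s' addr0 !mulrA s's mul1r.
Qed.

Lemma rho_rho_t x g : rho (rho x) * t g = t g * alpha g (rho x).
Proof. by rewrite rho_rho mulrDl fs_sum_t -mulrA s't mulr0 add0r. Qed.

Lemma t'_rho_rho x g : t' g * rho (rho x) = alpha g (rho x) * t' g.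
Proof.
rewrite rho_rho mulrDr; under eq_bigr do rewrite -mulrA.
by rewrite fs_sum_t' !mulrA t's !mul0r add0r.
Qed.

Lemma alphaK g x : alpha (- g) (alpha g x) = x.
Proof. by rewrite alphaD addNr alpha0. Qed.

Lemma alphaNK g x : alpha g (alpha (- g) x) = x.
Proof. by rewrite alphaD addrN alpha0. Qed.

Lemma alpha_inj g : injective (alpha g).
Proof. exact: can_inj (alphaK g). Qed.

Lemma alpha_rho_rho g x : alpha g (rho (rho x)) = rho (rho (alpha g x)).
Proof. by rewrite alpha_rho alpha_rho opprK. Qed.

Lemma scalerI_neq0 (v : A) : v != 0 -> injective (fun c : F => c *: v).
Proof.
move=> v0 c d E; apply/eqP; rewrite -subr_eq0.
by have /eqP := scalerBl c d v; rewrite E subrr scaler_eq0 (negPf v0) orbF.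
Qed.

Lemma s_neq0 : s != 0.
Proof. by apply: contra_eq_neq s's => ->; rewrite mulr0 eq_sym oner_neq0. Qed.

Lemma t_neq0 g : t g != 0.
Proof. by apply: contra_eq_neq (fs_t't1 g) => ->; rewrite mulr0 eq_sym oner_neq0. Qed.

Lemma t'_neq0 g : t' g != 0.
Proof. by apply: contra_eq_neq (fs_t't1 g) => ->; rewrite mul0r eq_sym oner_neq0. Qed.

(** Expand [r] on the left: [s' * r] lies in Hom(alpha g, id), and [t' h * r] lies in Hom(alpha g,
    alpha h rho), which is 0. *)
Lemma hom_alpha_rho_rho g r : (forall x, r * alpha g x = rho (rho x) * r) ->
  exists c, r = (c *+ (g == 0)) *: s.
Proof.
move=> rP; have [|c Ec] := @fs_hom_alpha _ _ _ _ _ _ _ _ _ sys g 0 (s' * r).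
  by move=> x; rewrite alpha0 -mulrA rP mulrA s'_rho_rho mulrA.
exists c; rewrite [LHS]fs_leftE Ec -scalerAr mulr1 big1 ?addr0 // => h _.
rewrite [t' h * r](fs_hom_alpha_rho sys (g := g) (h := h)) ?mulr0 // => x.
by rewrite -mulrA rP mulrA t'_rho_rho mulrA.
Qed.

(** Now [s' * r] lies in Hom(alpha g rho, id), which is 0, and [t' h * r] in Hom(alpha g rho, alpha
    h rho), which is 0 unless [h = g]. *)
Lemma hom_rho_rho_rho g r :
  (forall x, r * alpha g (rho x) = rho (rho x) * r) -> exists c, r = c *: t g.
Proof.
move=> rP; have rs : s' * r = 0.
  apply: (@fs_hom_rho_alpha _ _ _ _ _ _ _ _ _ sys g 0) => x.
  by rewrite alpha0 -mulrA rP mulrA s'_rho_rho mulrA.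
have Hh h : exists c, t' h * r = (c *+ (g == h))%:A.
  apply: (fs_hom_rho sys) => x.
  by rewrite -mulrA rP mulrA t'_rho_rho mulrA.
have [c Ec] := Hh g; exists c; rewrite [LHS]fs_leftE rs mulr0 add0r (bigD1 g) //= Ec eqxx.
rewrite -scalerAr mulr1 big1 ?addr0 // => h ne.
by have [d ->] := Hh h; rewrite eq_sym (negPf ne) mulr0n scale0r mulr0.
Qed.

Lemma hom_rho_rho_rho' g r :
  (forall x, r * rho (rho x) = alpha g (rho x) * r) -> exists c, r = c *: t' g.
Proof.
move=> rP; have rs : r * s = 0.
  apply: (@fs_hom_alpha_rho _ _ _ _ _ _ _ _ _ sys 0 g) => x.
  by rewrite alpha0 mulrA -rP -!mulrA rho_rho_s.
have Hh h : exists c, r * t h = (c *+ (h == g))%:A.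
  apply: (fs_hom_rho sys) => x.
  by rewrite mulrA -rP -!mulrA rho_rho_t.
have [c Ec] := Hh g; exists c; rewrite [LHS]fs_rightE rs mul0r add0r (bigD1 g) //= Ec eqxx.
rewrite -scalerAl mul1r big1 ?addr0 // => h ne.
by have [d ->] := Hh h; rewrite (negPf ne) mulr0n scale0r mul0r.
Qed.

(** As [alpha h] commutes with the square of [rho], it preserves the line Hom(id, rho rho). *)
Lemma alpha_s_scalar h : exists c, alpha h s = c *: s.
Proof.
have [|c Ec] := @hom_alpha_rho_rho 0 (alpha h s).
  move=> x; rewrite alpha0 -{1}(alphaNK h x) -alphaM -rho_rho_s alphaM.
  by rewrite alpha_rho_rho alphaNK.
by exists c; rewrite Ec eqxx.
Qed.

(** Conjugating [alpha g] composed with [rho] by [alpha h] gives index [g + h *+ 2], because moving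
    [alpha (- h)] across [rho] turns it into [alpha h]. *)
Lemma alpha_t_scalar h g : exists c, alpha h (t g) = c *: t (g + h *+ 2).
Proof.
apply: hom_rho_rho_rho => x.
have -> : alpha (g + h *+ 2) (rho x) = alpha h (alpha g (rho (alpha (- h) x))).
  by rewrite -alpha_rho !alphaD; congr (alpha _ _); zmod.
by rewrite -alphaM -rho_rho_t alphaM alpha_rho_rho alphaNK.
Qed.

Lemma alpha_t'_scalar h g : exists c, alpha h (t' g) = c *: t' (g + h *+ 2).
Proof.
apply: hom_rho_rho_rho' => x.
have -> : alpha (g + h *+ 2) (rho x) = alpha h (alpha g (rho (alpha (- h) x))).
  by rewrite -alpha_rho !alphaD; congr (alpha _ _); zmod.
by rewrite -alphaM -t'_rho_rho alphaM alpha_rho_rho alphaNK.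
Qed.

(** [rho s] intertwines [rho] with its cube, and [s'] contracts the outer two factors of the cube.
    The other contractions follow the same pattern. *)
Lemma s'_rho_s : exists c, s' * rho s = c%:A.
Proof.
have [|c Ec] := @fs_hom_rho _ _ _ _ _ _ _ _ _ sys 0 0 (s' * rho s).
  move=> x; rewrite !alpha0 -mulrA -rhoM -rho_rho_s rhoM mulrA.
  by rewrite s'_rho_rho mulrA.
by exists c; rewrite Ec eqxx.
Qed.

Lemma t'_rho_s g : exists c, t' g * rho s = c *: t g.
Proof.
apply: hom_rho_rho_rho => x.
rewrite alpha_rho -mulrA -rhoM -rho_rho_s rhoM mulrA t'_rho_rho.
by rewrite alpha_rho_rho alphaNK mulrA.
Qed.

Lemma rho_s'_s : exists c, rho s' * s = c%:A.
Proof.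
have [|c Ec] := @fs_hom_rho _ _ _ _ _ _ _ _ _ sys 0 0 (rho s' * s).
  by move=> x; rewrite !alpha0 -mulrA -rho_rho_s !mulrA -!rhoM s'_rho_rho.
by exists c; rewrite Ec eqxx.
Qed.

Lemma rho_s'_t g : exists c, rho s' * t g = c *: t' g.
Proof.
apply: hom_rho_rho_rho' => x.
have -> : rho (rho x) = alpha g (rho (rho (alpha (- g) x))).
  by rewrite alpha_rho_rho alphaNK.
rewrite -mulrA -rho_rho_t mulrA.
by rewrite -rhoM s'_rho_rho rhoM alpha_rho mulrA.
Qed.

Lemma rho_t_rho_rho g x : rho (t g) * rho (rho x) = rho (rho (rho (alpha g x))) * rho (t g).
Proof. by rewrite -!rhoM rho_rho_t alpha_rho alphaK. Qed.

Lemma s'_rho_t g : exists c, s' * rho (t g) = c *: t' (- g).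
Proof.
apply: hom_rho_rho_rho' => x.
by rewrite -mulrA rho_t_rho_rho mulrA s'_rho_rho alpha_rho opprK mulrA.
Qed.

Lemma t'_rho_t_rho_rho h g x :
  t' h * rho (t g) * rho (rho x) = rho (rho (alpha (h + g) x)) * (t' h * rho (t g)).
Proof.
by rewrite -mulrA rho_t_rho_rho mulrA t'_rho_rho alpha_rho_rho alphaD mulrA.
Qed.

(** By [t'_rho_t_rho_rho] the product lies in Hom(alpha (- (h + g)), rho rho), which is 0 unless
    [h = - g]. *)
Lemma t'_rho_t_s h g : exists c, t' h * rho (t g) * s = (c *+ (h == - g)) *: s.
Proof.
have [|c Ec] := @hom_alpha_rho_rho (- (h + g)) (t' h * rho (t g) * s).
  by move=> x; rewrite -mulrA -rho_rho_s mulrA t'_rho_t_rho_rho alphaNK !mulrA.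
by exists c; rewrite Ec oppr_eq0 addr_eq0.
Qed.

Lemma t'_rho_t_t h g l : exists c, t' h * rho (t g) * t l = c *: t (h + l + g).
Proof.
apply: hom_rho_rho_rho => x.
have -> : alpha (h + l + g) (rho x) = alpha l (rho (alpha (- (h + g)) x)).
  by rewrite -alpha_rho alphaD; congr (alpha _ _); zmod.
by rewrite -mulrA -rho_rho_t mulrA t'_rho_t_rho_rho alphaNK !mulrA.
Qed.

End Intertwiners.

(** * Zigzag relations, and invariance of [s] under [alpha] *)

Section CharacterTrivial.
Variables (F : fieldType) (G : finZmodType) (A : algType F).
Variables (alpha : G -> {lrmorphism A -> A}) (rho : {lrmorphism A -> A}).
Variables (s s' : A) (t t' : G -> A).
Hypothesis sys : fusion_system alpha rho s s' t t'.
Hypothesis odd_G : odd #|G|.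

Let alphaM g x y : alpha g (x * y) = alpha g x * alpha g y.
Proof. exact: rmorphM. Qed.
Let rhoM x y : rho (x * y) = rho x * rho y.
Proof. exact: rmorphM. Qed.
Let alphaZ g c x : alpha g (c *: x) = c *: alpha g x.
Proof. exact: linearZ. Qed.
Let rhoZ c x : rho (c *: x) = c *: rho x.
Proof. exact: linearZ. Qed.
(** Rewriting with these rules moves scalars to the front of products and merges them. *)
Let outE := (=^~ @scalerAl F A, =^~ @scalerAr F A, @scalerA F A, @mul1r A, @mulr1 A).

Lemma rho_s_eq a (b : G -> F) : s' * rho s = a%:A ->
  (forall g, t' g * rho s = b g *: t g) ->
  rho s = a *: s + \sum_g b g *: (t g * t g).
Proof.
move=> Ea Eb; rewrite [LHS](fs_leftE sys) Ea -scalerAr mulr1; congr (_ + _).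
by apply: eq_bigr => g _; rewrite Eb -scalerAr.
Qed.

Lemma rho_rho_s_eq a (b : G -> F) : s' * rho s = a%:A ->
  (forall g, t' g * rho s = b g *: t g) ->
  rho (rho s) = a *: rho s + \sum_g b g *: (rho (t g) * rho (t g)).
Proof.
move=> Ea Eb; rewrite {1}(rho_s_eq Ea Eb) raddfD raddf_sum /= rhoZ; congr (_ + _).
by apply: eq_bigr => g _; rewrite rhoZ rhoM.
Qed.

(** Both sides are compared after right multiplication by [s] and by each [t l]; in the second case
    a multiple of some [t] appears, which [s'] kills. *)
Lemma s'_t'_rho_t (C : G -> F) :
  (forall g, t' (- g) * rho (t g) * s = C g *: s) ->
  forall h g, s' * t' h * rho (t g) = (C g *+ (h == - g)) *: s'.
Proof.
move=> EC h g; apply: (fs_eqr sys) => [|l]; rewrite -2!mulrA (mulrA (t' h)) !outE.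
  rewrite (fs_s's sys).
  have [-> |ne] := eqVneq h (- g); first by rewrite EC !outE (fs_s's sys).
  have [c ->] := t'_rho_t_s sys h g.
  by rewrite (negPf ne) !scale0r mulr0.
have [c ->] := t'_rho_t_t sys h g l.
by rewrite !outE !(fs_s't sys) !scaler0.
Qed.

(* The contraction s' * rho (rho s) * s. *)
Lemma zigzag_sum a (b B C : G -> F) :
  s' * rho s = a%:A -> (forall g, t' g * rho s = b g *: t g) ->
  (forall g, s' * rho (t g) = B g *: t' (- g)) ->
  (forall g, t' (- g) * rho (t g) * s = C g *: s) ->
  a ^+ 2 + \sum_g b g * B g * C g = 1.
Proof.
move=> Ea Eb EB EC; apply: (scalerI_neq0 (s_neq0 sys)).
rewrite /= scale1r -[RHS]mulr1 -(fs_s's sys) mulrA.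
rewrite -(s'_rho_rho sys) (rho_rho_s_eq Ea Eb) mulrDr mulrDl !outE Ea !outE.
rewrite -expr2 scalerDl mulr_sumr mulr_suml scaler_suml; congr (_ + _).
apply: eq_bigr => g _; rewrite !outE mulrA EB !outE EC !outE.
by congr (_ *: _); ring.
Qed.

(* The contraction s' * t' (- g) * rho (rho s) * t (- g). *)
Lemma zigzag_prod a (b B C : G -> F) g c :
  s' * rho s = a%:A -> (forall g, t' g * rho s = b g *: t g) ->
  (forall g, s' * rho (t g) = B g *: t' (- g)) ->
  (forall g, t' (- g) * rho (t g) * s = C g *: s) ->
  alpha g s = c *: s -> b g * B g * C g = c * a.
Proof.
move=> Ea Eb EB EC Ec; apply: (scalerI_neq0 (oner_neq0 A)) => /=.
have sE : s' * (t' (- g) * rho (rho s)) * t (- g) = (c * a)%:A.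
  rewrite (t'_rho_rho sys) (fs_alpha_rho sys) opprK Ec rhoZ !outE.
  by rewrite mulrA Ea !outE (fs_t't1 sys).
rewrite -sE (rho_rho_s_eq Ea Eb) mulrDr !outE Eb mulrDr mulrDl.
rewrite !outE (fs_s't sys) mul0r scaler0 add0r.
rewrite !mulr_sumr mulr_suml (bigD1 g) //= big1 ?addr0 => [|k ne].
  rewrite !outE 2!mulrA (s'_t'_rho_t EC) eqxx mulr1n !outE EB !outE (fs_t't1 sys).
  by congr (_ *: _); ring.
rewrite !outE 2!mulrA (s'_t'_rho_t EC) eqr_opp eq_sym (negPf ne) scale0r mul0r.
by rewrite mul0r scaler0.
Qed.

(* The two zigzag relations exclude s' * rho s = 0, and applying alpha to
   s' * rho s then shows that the character of alpha on s has order at most 2. *)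
Lemma alpha_s h : alpha h s = s.
Proof.
have [chi chiE] := choice (alpha_s_scalar sys).
have [a Ea] := s'_rho_s sys.
have [b Eb] := choice (t'_rho_s sys).
have [B EB] := choice (s'_rho_t sys).
have EC g : exists c, t' (- g) * rho (t g) * s = c *: s.
  by have [c Ec] := t'_rho_t_s sys (- g) g; exists c; rewrite Ec eqxx.
have [C {}EC] := choice EC.
have sI := scalerI_neq0 (s_neq0 sys).
have chiD g k : chi (g + k) = chi g * chi k.
  apply: sI; rewrite /= -chiE -(fs_alphaD sys) chiE alphaZ chiE.
  by rewrite scalerA mulrC.
have chi0 : chi 0 = 1 by apply: sI; rewrite /= -chiE (fs_alpha0 sys) scale1r.
have sum_eq := zigzag_sum Ea Eb EB EC.
have prod_eq g := zigzag_prod Ea Eb EB EC (chiE g).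
have a0 : a != 0.
  apply: contra_eq_neq sum_eq => a0; rewrite a0 expr0n add0r big1 => [|g _].
    by rewrite eq_sym oner_neq0.
  by rewrite prod_eq a0 mulr0.
have chiN g : chi g * chi (- g) = 1 by rewrite -chiD addrN.
have chi'E g : alpha g s' = chi (- g) *: s'.
  apply: (fs_eqr sys) => [|k].
    have E1 : chi g *: (alpha g s' * s) = 1.
      by rewrite scalerAr -chiE -alphaM (fs_s's sys) rmorph1.
    by rewrite !outE (fs_s's sys) -[LHS]scale1r -(chiN g) mulrC -scalerA E1.
  rewrite !outE (fs_s't sys) scaler0 -[t k](alphaNK sys g) -alphaM.
  have [c ->] := alpha_t_scalar sys (- g) k.
  by rewrite !outE alphaZ (fs_s't sys) raddf0 scaler0.
have chi2 g : chi g ^+ 2 = 1.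
  (* Under [alpha k] both [s'] and [rho s] scale by [chi (- k)], the latter because [alpha k]
     crosses [rho] as [alpha (- k)]; hence the choice of [k]. *)
  rewrite -[g]opprK; set k := - g.
  have : alpha k (s' * rho s) = a%:A by rewrite Ea alphaZ rmorph1.
  rewrite alphaM chi'E (fs_alpha_rho sys) chiE rhoZ !outE Ea !outE.
  move/(scalerI_neq0 (oner_neq0 A)); rewrite -expr2.
  by move/(canRL (mulfK a0)); rewrite mulfV.
(* Odd order makes every [h] a double, so [chi h] is a square of a sign. *)
have -> : h = halve h + halve h by rewrite -mulr2n halveK.
by rewrite chiE chiD -expr2 chi2 scale1r.
Qed.

End CharacterTrivial.

(** * Relations among the structure constants and the matrix [M] *)

Section Relations.
Variables (F : fieldType) (G : finZmodType) (A : algType F).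
Variables (alpha : G -> {lrmorphism A -> A}) (rho : {lrmorphism A -> A}).
Variables (s s' : A) (t t' : G -> A).
Hypothesis sys : fusion_system alpha rho s s' t t'.
Hypothesis alpha_s1 : forall h, alpha h s = s.
Hypothesis alpha_s'1 : forall h, alpha h s' = s'.
Hypothesis alpha_t : forall h g, alpha h (t g) = t (g + h *+ 2).
Variables (a a' b b' B C : F) (M : G -> G -> F).
Hypothesis Ea : s' * rho s = a%:A.
Hypothesis Eb : forall g, t' g * rho s = b *: t g.
Hypothesis Ea' : rho s' * s = a'%:A.
Hypothesis Eb' : forall g, rho s' * t g = b' *: t' g.
Hypothesis EB : forall g, s' * rho (t g) = B *: t' (- g).
Hypothesis EC : forall h g, t' h * rho (t g) * s = (C *+ (h == - g)) *: s.
Hypothesis EM : forall h g l,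
  t' h * rho (t g) * t l = M (h + g) (l + g) *: t (h + l + g).

Let rhoM x y : rho (x * y) = rho x * rho y.
Proof. exact: rmorphM. Qed.
Let rhoZ c x : rho (c *: x) = c *: rho x.
Proof. exact: linearZ. Qed.
Let outE := (=^~ @scalerAl F A, =^~ @scalerAr F A, @scalerA F A, @mul1r A, @mulr1 A).
Let t't g h : t' g * t h = ((g == h)%:R : F)%:A.
Proof. by rewrite (fs_t't sys) scaler_nat. Qed.
Let t't1 g : t' g * t g = 1 := fs_t't1 sys g.
Let tI g := scalerI_neq0 (t_neq0 sys g).
Let t'I g := scalerI_neq0 (t'_neq0 sys g).
Let oneI := scalerI_neq0 (oner_neq0 A).

Let alpha_rho_s h : alpha h (rho s) = rho s.
Proof. by rewrite (fs_alpha_rho sys) alpha_s1. Qed.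

Let alpha_rho_s' h : alpha h (rho s') = rho s'.
Proof. by rewrite (fs_alpha_rho sys) alpha_s'1. Qed.

Let alpha_rho_t h g : alpha h (rho (t g)) = rho (t (g - h *+ 2)).
Proof. by rewrite (fs_alpha_rho sys) alpha_t mulNrn. Qed.

Lemma rho_sE : rho s = a *: s + b *: \sum_k t k * t k.
Proof. by rewrite (rho_s_eq sys Ea Eb) scaler_sumr. Qed.

Lemma rho_s'E : rho s' = a' *: s' + b' *: \sum_k t' k * t' k.
Proof.
rewrite [LHS](fs_rightE sys) Ea' !outE scaler_sumr; congr (_ + _).
by apply: eq_bigr => g _; rewrite Eb' !outE.
Qed.

(** Expansion by the partition of unity on both sides; in the column of [s] only the row [l = - g]
    survives. *)
Lemma rho_tE g : rho (t g) = B *: (s * t' (- g)) + C *: (t (- g) * s * s')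
  + \sum_l \sum_k M (l + g) (k + g) *: (t l * t (l + k + g) * t' k).
Proof.
rewrite [LHS](fs_leftE sys) EB !outE -addrA; congr (_ + _).
have row l : t l * (t' l * rho (t g)) = (C *+ (l == - g)) *: (t l * s * s')
    + \sum_k M (l + g) (k + g) *: (t l * t (l + k + g) * t' k).
  rewrite [t' l * _](fs_rightE sys) mulrDr EC !outE mulrA mulr_sumr.
  by congr (_ + _); apply: eq_bigr => k _; rewrite EM !outE mulrA.
under eq_bigr do rewrite row.
rewrite big_split /=; congr (_ + _).
rewrite (bigD1 (- g)) //= eqxx big1 ?addr0 // => l ne.
by rewrite (negPf ne) scale0r.
Qed.

Lemma rho_t_s g : rho (t g) * s = C *: (t (- g) * s).
Proof.
apply: (fs_eql sys) => [|h].
  by rewrite mulrA EB !outE mulrA (fs_t's sys) (fs_s't sys) mul0r !scaler0.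
rewrite mulrA EC !outE mulrA t't !outE.
by congr (_ *: _); rewrite mulr_natr.
Qed.

Lemma t'_t'_rho_t q p l :
  t' q * t' p * rho (t l) = M (p + l) (q - p) *: t' (q - p - l).
Proof.
apply: (fs_eqr sys) => [|k]; rewrite -2!mulrA (mulrA (t' p)).
  by rewrite EC !outE !(fs_t's sys) !scaler0.
rewrite EM !outE !t't !scalerA; congr (_ *: _).
have -> : (q == p + k + l) = (q - p - l == k).
  by rewrite !subr_eq; congr (_ == _); zmod.
by case: eqP => [<-|_]; rewrite ?mulr0 // subrK.
Qed.

Lemma t'_t'_rho_s q p : t' q * t' p * rho s = (b * (q == p)%:R)%:A.
Proof. by rewrite -mulrA Eb !outE t't !outE. Qed.

Lemma bBC : b * B * C = a.
Proof.
rewrite -[RHS]mul1r.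
apply: (@zigzag_prod _ _ _ _ _ _ _ _ _ sys a (fun=> b) (fun=> B) (fun=> C) 0) => //.
  by move=> g; rewrite EC eqxx.
by rewrite alpha_s1 scale1r.
Qed.

Lemma a_quadratic : a ^+ 2 + #|G|%:R * a = 1.
Proof.
rewrite -[RHS](@zigzag_sum _ _ _ _ _ _ _ _ _ sys a (fun=> b) (fun=> B) (fun=> C)) //.
  by rewrite bBC sumr_const mulr_natl.
by move=> g; rewrite EC eqxx.
Qed.

Lemma a_neq0 : a != 0.
Proof.
apply: contra_eq_neq a_quadratic => ->.
by rewrite expr0n mulr0 addr0 eq_sym oner_neq0.
Qed.

Lemma b_neq0 : b != 0.
Proof. by apply: contraNneq a_neq0 => b0; rewrite -bBC b0 !mul0r. Qed.
Lemma B_neq0 : B != 0.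
Proof. by apply: contraNneq a_neq0 => b0; rewrite -bBC b0 mulr0 mul0r. Qed.
Lemma C_neq0 : C != 0.
Proof. by apply: contraNneq a_neq0 => b0; rewrite -bBC b0 mulr0. Qed.

Let rr_s : rho (rho s) = a *: rho s + b *: \sum_g rho (t g) * rho (t g).
Proof. by rewrite (rho_rho_s_eq sys Ea Eb) scaler_sumr. Qed.

(* The contraction t' 0 * rho (rho s) * s. *)
Lemma sum_M_0 : \sum_h M h 0 = - (C^-1 * a).
Proof.
have E : t' 0 * rho (rho s) * s = 0.
  by rewrite -mulrA (rho_rho_s sys) mulrA (fs_t's sys) mul0r.
have: b *: ((a + C * \sum_h M h 0) *: (t 0 * s)) = 0.
  rewrite -E rr_s mulrDr mulrDl !outE Eb !outE mulrDr scalerDl (mulrC b a).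
  congr (_ + _); rewrite -scalerA; congr (_ *: _).
  rewrite [t' 0 * _]mulr_sumr mulr_suml mulr_sumr scaler_suml; apply: eq_bigr => g _.
  rewrite -2!mulrA rho_t_s !outE 2!mulrA EM !outE !add0r addNr.
  by congr (_ *: _); ring.
move/eqP; rewrite !scaler_eq0 (negPf b_neq0) /=.
have -> : (t 0 * s == 0) = false.
  apply/negbTE; apply: contra_neq (s_neq0 sys) => E0.
  by rewrite -[s]mul1r -(t't1 0) -mulrA E0 mulr0.
rewrite orbF addr_eq0 => /eqP Ea0.
by rewrite Ea0 mulrN opprK mulKf ?C_neq0.
Qed.

(* The contraction t' (h + k) * t' h * rho (rho s) * t 0. *)
Lemma quadratic_M h k :
  \sum_g M (h + g) k * M k g = (h == 0)%:R - a * (k == 0)%:R.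
Proof.
(* First evaluation: [t' h] passes the square of [rho], and [rho s] is fixed by [alpha]. The second
   one, [E2], expands by [rr_s]. *)
have E1 : t' (h + k) * t' h * rho (rho s) * t 0 = (b * (h == 0)%:R) *: t (h + k).
  rewrite -(mulrA (t' (h + k))) (t'_rho_rho sys) alpha_rho_s -2!mulrA t't !outE.
  by rewrite Eb !outE mulrC.
have E2 : t' (h + k) * t' h * rho (rho s) * t 0
    = (a * b * (k == 0)%:R) *: t 0 + b *: ((\sum_g M (h + g) k * M k g) *: t k).
  rewrite rr_s mulrDr mulrDl !outE t'_t'_rho_s !outE; congr (_ *: _ + _).
    by rewrite -[X in _ == X]addr0 (inj_eq (addrI h)) mulrA.
  rewrite -[RHS]scalerA; congr (_ *: _).
  rewrite mulr_sumr mulr_suml scaler_suml; apply: eq_bigr => g _.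
  rewrite (mulrA _ (rho (t g))) t'_t'_rho_t !outE EM !outE add0r.
  by congr ((_ * M _ _) *: t _); rewrite ?(addrC h) ?addrK ?subrK ?addr0 ?subrK.
(* The Kronecker factors allow every term to be written as a multiple of the single vector [t k]. *)
have Eh : (b * (h == 0)%:R) *: t (h + k) = (b * (h == 0)%:R) *: t k.
  by case: eqP => [->|_]; rewrite ?add0r // mulr0 !scale0r.
have Ek : (a * b * (k == 0)%:R) *: t 0 = (a * b * (k == 0)%:R) *: t k.
  by case: eqP => [->|_] //; rewrite mulr0 !scale0r.
move: E2; rewrite E1 Eh Ek scalerA -scalerDl => /(@tI k) E3.
by apply: (mulfI b_neq0); rewrite mulrBr E3; ring.
Qed.

(* From B t'_{-g} = s' rho(t_g). *)
Lemma rho_t'_s g : B *: (rho (t' g) * s) = a' *: t (- g).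
Proof.
rewrite scalerAl -rhoZ -[g]opprK -EB rhoM opprK.
by rewrite -mulrA (rho_rho_s sys) mulrA Ea' !outE.
Qed.

(** Moving [t h] across the square of [rho] produces [alpha h] on [rho (t (- g))], hence the index
    [- g - h *+ 2]. *)
Lemma rho_t'_t g h : B *: (rho (t' g) * t h) = b' *: (t' h * rho (t (- g - h *+ 2))).
Proof.
rewrite scalerAl -rhoZ -[g]opprK -EB rhoM opprK.
by rewrite -mulrA (rho_rho_t sys) mulrA Eb' !outE alpha_rho_t.
Qed.

(* From b t_g = t'_g rho(s). *)
Lemma a'_eq : a' = a.
Proof.
have ts0 : t 0 * s != 0.
  apply: contra_neq (s_neq0 sys) => E0.
  by rewrite -[s]mul1r -(t't1 0) -mulrA E0 mulr0.
apply/esym; rewrite -bBC; apply: (scalerI_neq0 ts0) => /=.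
have E : b *: (rho (t 0) * s) = rho (t' 0) * s * s.
  by rewrite scalerAl -rhoZ -Eb rhoM -[LHS]mulrA (rho_rho_s sys) mulrA.
have E' : B *: (b *: (rho (t 0) * s)) = (a' *: t 0) * s.
  by rewrite E scalerAl rho_t'_s oppr0.
rewrite [RHS]scalerAl -E' rho_t_s oppr0 !scalerA.
by congr (_ *: _); ring.
Qed.

(** Apply [rho] to b t_0 = t'_0 rho(s), multiply by t_0 on the right and by B s' on the left. One
    side is evaluated with [EB], the other with [rho_t'_t]. *)
Lemma b'_C_a : b' * C * a = b * B ^+ 2.
Proof.
apply: oneI => /=.
have E : b *: (rho (t 0) * t 0) = rho (t' 0) * t 0 * rho s.
  by rewrite scalerAl -rhoZ -Eb rhoM -[LHS]mulrA (rho_rho_t sys) mulrA alpha_rho_s.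
have E' : B *: (s' * (b *: (rho (t 0) * t 0))) = (b' * C * a)%:A.
  rewrite E (scalerAr B s') scalerAl rho_t'_t oppr0 mul0rn subr0 !outE 2!mulrA.
  rewrite (s'_t'_rho_t sys (C := fun=> C)); last by move=> g; rewrite EC eqxx.
  by rewrite oppr0 eqxx mulr1n !outE Ea !outE; congr (_ *: _); ring.
rewrite -E' !outE mulrA EB !outE oppr0 t't1.
by congr (_ *: _); ring.
Qed.

Lemma b'_neq0 : b' != 0.
Proof.
have : b' * C * a != 0 by rewrite b'_C_a mulf_neq0 ?expf_neq0 ?b_neq0 ?B_neq0.
by rewrite !mulf_eq0 !negb_or => /andP[/andP[]].
Qed.

(* From b' t'_g = rho(s') t_g. *)
Lemma rho_t'_rr g : b' *: rho (t' g) = rho (rho s') * rho (t g).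
Proof. by rewrite -rhoZ -Eb' rhoM. Qed.

(** Compare two values of rho(t'_0) s: the one from [rho_t'_rr], where rho(t_0) s = C t_0 s, and the
    one from [rho_t'_s]. *)
Lemma b'_eq : b' = C * B.
Proof.
apply: (mulIf a_neq0); apply: (@tI 0) => /=.
have E : b' *: (rho (t' 0) * s) = (C * a) *: t 0.
  rewrite scalerAl rho_t'_rr -mulrA rho_t_s !outE mulrA (rho_rho_t sys) oppr0.
  by rewrite alpha_rho_s' -mulrA Ea' a'_eq !outE.
have E' : b' *: (B *: (rho (t' 0) * s)) = B *: ((C * a) *: t 0).
  by rewrite -E !scalerA mulrC.
move: E'; rewrite rho_t'_s oppr0 a'_eq !scalerA => ->.
by congr (_ *: _); ring.
Qed.

(** Substituting b' = C B in [b'_C_a] gives C^2 a = b B; multiply by C and use [bBC]. *)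
Lemma C_cube : C ^+ 3 = 1.
Proof.
have := b'_C_a; rewrite b'_eq => E.
apply: (mulIf a_neq0); apply: (mulIf B_neq0).
rewrite mul1r -{2}bBC.
have -> : C ^+ 3 * a * B = C * (C * B * C * a) by ring.
by rewrite E; ring.
Qed.

(** In [rho_t'_rr], [t' k] passes [rho (rho s')] and leaves the contraction [EM]; thus [rho (t' g)]
    has the same coefficients [M] as [rho (t g)]. *)
Lemma t'_rho_t'_t k g l :
  t' k * rho (t' g) * t l = M (k + g) (l + g) *: t' (k + l + g).
Proof.
apply: (scalerI b'_neq0); rewrite scalerAl scalerAr rho_t'_rr mulrA (t'_rho_rho sys).
by rewrite alpha_rho_s' -!mulrA (mulrA (t' k)) EM !outE Eb' !outE mulrC.
Qed.

Lemma s'_rho_t'_t g l : s' * rho (t' g) * t l = (C^-1 * (- g == l)%:R) *: s'.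
Proof.
apply: (scalerI b'_neq0); rewrite scalerAl scalerAr rho_t'_rr mulrA (s'_rho_rho sys).
rewrite -(mulrA s' s') EB !outE -mulrA t't !outE; congr (_ *: _).
by rewrite b'_eq mulrA [C * B]mulrC mulfK ?C_neq0.
Qed.

Lemma rho_t'E g : rho (t' g) = (C * b) *: (t (- g) * s') + C^-1 *: (s * s' * t' (- g))
  + \sum_l \sum_k M (k + g) (l + g) *: (t k * t' (g + l + k) * t' l).
Proof.
rewrite [LHS](fs_rightE sys) -addrA; congr (_ + _).
  (* The coefficient is a / B, which [bBC] turns into C b. *)
  rewrite scalerAl; congr (_ * _); apply: (scalerI B_neq0).
  by rewrite rho_t'_s a'_eq -bBC scalerA; congr (_ *: _); ring.
have col l : rho (t' g) * t l * t' l = (C^-1 * (- g == l)%:R) *: (s * s' * t' l)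
    + \sum_k M (k + g) (l + g) *: (t k * t' (g + l + k) * t' l).
  rewrite [rho (t' g) * t l](fs_leftE sys) mulrDl (mulrA s') s'_rho_t'_t !outE.
  congr (_ + _); rewrite mulr_suml; apply: eq_bigr => k _.
  rewrite (mulrA (t' k)) t'_rho_t'_t !outE; congr (_ *: (_ * t' _ * _)); zmod.
under eq_bigr do rewrite col.
rewrite big_split /=; congr (_ + _).
rewrite (bigD1 (- g)) //= eqxx mulr1 big1 ?addr0 // => l ne.
by rewrite eq_sym (negPf ne) mulr0 scale0r.
Qed.

(** Two evaluations of [t' x * rho (t' 0) * t y], directly and through [rho_t'_t]; the factor C is
    b' / B. *)
Lemma rotation_M x y : M x y = C * M (- y) (x - y).
Proof.
have E := rho_t'_t 0 y.
have : B *: (t' x * rho (t' 0) * t y) = b' *: (t' x * t' y * rho (t (- 0 - y *+ 2))).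
  by rewrite -mulrA scalerAr E !outE mulrA.
rewrite t'_rho_t'_t t'_t'_rho_t !addr0 oppr0 !scalerA.
have -> : x - y - (0 - y *+ 2) = x + y by zmod.
move/(@t'I (x + y)); rewrite b'_eq.
have -> : y + (0 - y *+ 2) = - y by zmod.
by move=> E'; apply: (mulfI B_neq0); rewrite E'; ring.
Qed.

Lemma rho_t'_t_t k u v : rho (t' k) * t u * t v = M (v - u) (u + k) *: t (v - u - k).
Proof.
apply: (scalerI B_neq0); rewrite scalerAl rho_t'_t -scalerAl EM.
rewrite (rotation_M (v - u)) !scalerA b'_eq.
have -> : u + (- k - u *+ 2) = - (u + k) by zmod.
have -> : v + (- k - u *+ 2) = v - u - (u + k) by zmod.
have -> : u + v + (- k - u *+ 2) = v - u - k by zmod.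
by congr (_ *: _); ring.
Qed.

(* The contraction t' (h + i) * t' (g + h) * t' g * rho (rho (t 0)) * t k * t (i + k). *)
Lemma quartic_M g h i k :
  \sum_l \sum_m M l m * M (l + g) h * M (h + m) (l + i) * M i (k + m) =
  M (h - g) (i - g) * (k == g)%:R - C^-1 * a * (h == 0)%:R * M i k
  - C * a * M g h * (i == 0)%:R.
Proof.
pose L := t' (h + i) * t' (g + h) * t' g; pose Q := t k * t (i + k).
(* First evaluation: [t' g] passes the square of [rho] and meets [t k]. The facts that follow
   evaluate the same scalar through the expansion [rr_t]. *)
have direct : L * rho (rho (t 0)) * Q = (M (h - g) (i - g) * (k == g)%:R)%:A.
  rewrite /L /Q -(mulrA _ (t' g)) (t'_rho_rho sys) alpha_rho_t -(mulrA _ (_ * t' g)).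
  rewrite -(mulrA (rho _)) (mulrA (t' g)) t't !outE mulrA t'_t'_rho_t !outE t't !outE.
  have -> : g + h + (0 - g *+ 2) = h - g by zmod.
  have -> : h + i - (g + h) = i - g by zmod.
  have -> : i - g - (0 - g *+ 2) = i + g by zmod.
  congr (_ *: _); rewrite (inj_eq (addrI i)) (eq_sym g).
  by case: eqP => _; rewrite ?(mulr1, mul1r, mulr0, mul0r).
have Ls : L * rho s = (b * (h == 0)%:R) *: t' (h + i).
  rewrite /L -2!mulrA (mulrA (t' (g + h))) t'_t'_rho_s !outE.
  by rewrite -[X in _ == X]addr0 (inj_eq (addrI g)).
have Lt l : L * rho (t l) = M (g + l) h *: (t' (h + i) * t' (h - l)).
  rewrite /L -2!mulrA (mulrA (t' (g + h))) t'_t'_rho_t !outE.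
  by congr (M _ _ *: (_ * t' _)); zmod.
have Qt' m : rho (t' m) * Q = M i (k + m) *: t (i - m).
  by rewrite /Q mulrA rho_t'_t_t; congr (M _ _ *: t _); zmod.
have Qs' : rho s' * Q = (b' * (i == 0)%:R)%:A.
  rewrite /Q mulrA Eb' !outE t't !outE.
  by rewrite -{1}[k]add0r (inj_eq (addIr k)) eq_sym.
have rr_t : rho (rho (t 0)) = B *: (rho s * rho (t' 0))
    + C *: (rho (t 0) * rho s * rho s')
    + \sum_l \sum_m M l m *: (rho (t l) * rho (t (l + m)) * rho (t' m)).
  rewrite {1}(rho_tE 0) !raddfD raddf_sum /= !rhoZ !rhoM oppr0; congr (_ + _).
  apply: eq_bigr => l _; rewrite raddf_sum /=; apply: eq_bigr => m _.
  by rewrite rhoZ !rhoM !addr0.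
move: direct; rewrite rr_t !mulrDr !mulrDl !outE.
have -> : L * (rho s * rho (t' 0)) * Q = (b * (h == 0)%:R * M i k)%:A.
  rewrite (mulrA L) Ls -mulrA Qt' !outE t't addr0 subr0 !outE.
  have -> : (h + i == i) = (h == 0) by rewrite -subr_eq0 addrK.
  congr (_ *: _).
  by case: eqP => _; rewrite ?(mulr1, mul1r, mulr0, mul0r).
have -> : L * (rho (t 0) * rho s * rho s') * Q = (b * b' * M g h * (i == 0)%:R)%:A.
  rewrite -2!mulrA Qs' !outE mulrA Lt !outE subr0 t'_t'_rho_s !outE addr0.
  have -> : (h + i == h) = (i == 0) by rewrite -subr_eq0 addrAC subrr add0r.
  congr (_ *: _).
  by case: eqP => _; rewrite ?(mulr1, mul1r, mulr0, mul0r) //; ring.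
rewrite !scalerA.
have -> : L * (\sum_l \sum_m M l m *: (rho (t l) * rho (t (l + m)) * rho (t' m))) * Q
    = (\sum_l \sum_m M l m * M (l + g) h * M (h + m) (l + i) * M i (k + m))%:A.
  rewrite mulr_sumr mulr_suml scaler_suml; apply: eq_bigr => l _.
  rewrite mulr_sumr mulr_suml scaler_suml; apply: eq_bigr => m _.
  rewrite !outE !(mulrA L) Lt -(mulrA _ (rho (t' m))) Qt' !outE t'_t'_rho_t !outE t't !outE.
  have -> : h - l + (l + m) = h + m by zmod.
  have -> : h + i - (h - l) = l + i by zmod.
  have -> : l + i - (l + m) = i - m by zmod.
  by rewrite eqxx mulr1 (addrC g); congr (_ *: _); ring.
rewrite -!scalerDl => /oneI E.
rewrite -{}E b'_eq.
(* The two exceptional terms carry b B = a / C and C b b' = C a, the latter by [b'_eq] and [bBC]. *)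
have -> : C^-1 * a = b * B by rewrite -bBC mulrC mulfK ?C_neq0.
by rewrite -bBC; ring.
Qed.

End Relations.

(** * Rescaling of the generators *)

Section Normalization.
Variables (F : fieldType) (G : finZmodType) (A : algType F).
Variables (alpha : G -> {lrmorphism A -> A}) (rho : {lrmorphism A -> A}).
Variables (s s' : A) (t t' : G -> A).
Hypothesis sys : fusion_system alpha rho s s' t t'.

Let outE := (=^~ @scalerAl F A, =^~ @scalerAr F A, @scalerA F A, @mul1r A, @mulr1 A).

(** In each relation the scalars of [t] and [t'] cancel, or the relation asserts a vanishing. *)
Lemma rescale_t (d : G -> F) : (forall g, d g != 0) ->
  fusion_system alpha rho s s' (fun g => d g *: t g) (fun g => (d g)^-1 *: t' g).
Proof.
move=> d0; split; try by case: sys.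
- by move=> g; rewrite !outE (fs_s't sys) scaler0.
- by move=> g; rewrite !outE (fs_t's sys) scaler0.
- move=> g h; rewrite !outE (fs_t't sys); case: eqVneq => [->|_]; last by rewrite scaler0.
  by rewrite ?(mulVf, mulfV) // scale1r.
- rewrite -(fs_sum1 sys); congr (_ + _); apply: eq_bigr => g _.
  by rewrite !outE ?(mulVf, mulfV) // scale1r.
- move=> x; rewrite (fs_rho_rho sys); congr (_ + _); apply: eq_bigr => g _.
  by rewrite !outE ?(mulVf, mulfV) // scale1r.
Qed.

Lemma rescale_s (c : F) : c != 0 ->
  fusion_system alpha rho (c *: s) (c^-1 *: s') t t'.
Proof.
move=> c0; split; try by case: sys.
- by rewrite !outE ?(mulVf, mulfV) // scale1r (fs_s's sys).
- by move=> g; rewrite !outE (fs_s't sys) scaler0.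
- by move=> g; rewrite !outE (fs_t's sys) scaler0.
- by rewrite !outE ?(mulVf, mulfV) // scale1r (fs_sum1 sys).
- by move=> x; rewrite !outE ?(mulVf, mulfV) // scale1r (fs_rho_rho sys).
Qed.

Hypothesis odd_G : odd #|G|.

(** The rescaled generator of index [g] is the image of [t 0] under [alpha (halve g)], so the claim
    reduces to additivity of halving. *)
Lemma normalize : exists2 d : G -> F, forall g, d g != 0 &
  forall h g, alpha h (d g *: t g) = d (g + h *+ 2) *: t (g + h *+ 2).
Proof.
have [d dE] := choice (fun g => alpha_t_scalar sys (halve g) 0).
have {}dE g : alpha (halve g) (t 0) = d g *: t g by rewrite dE add0r halveK.
exists d => [g|h g].
  apply: contraNneq (t_neq0 sys 0) => d0; apply/eqP/(alpha_inj sys (g := halve g)).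
  by rewrite dE d0 scale0r raddf0.
rewrite -!dE (fs_alphaD sys); congr (alpha _ _).
rewrite addrC /halve mulrnDl; congr (_ + _).
by rewrite -[LHS](halveK _ odd_G) /halve -!mulrnA mulnC.
Qed.

Hypothesis alpha_t : forall h g, alpha h (t g) = t (g + h *+ 2).

Lemma alpha_t' h g : alpha h (t' g) = t' (g + h *+ 2).
Proof.
have [c Ec] := alpha_t'_scalar sys h g.
have : alpha h (t' g) * alpha h (t g) = 1.
  by rewrite -rmorphM (fs_t't1 sys) rmorph1.
rewrite Ec alpha_t !outE (fs_t't1 sys) -[RHS]scale1r.
by move/(scalerI_neq0 (oner_neq0 A)) => ->; rewrite scale1r.
Qed.

Lemma alpha_s' h : alpha h s' = s'.
Proof.
apply: (fs_eqr sys) => [|k].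
  by rewrite -{1}(alpha_s sys odd_G h) -rmorphM (fs_s's sys) rmorph1.
rewrite (fs_s't sys) -[k](subrK (h *+ 2)) -alpha_t -rmorphM (fs_s't sys).
exact: raddf0.
Qed.

Let t_0 g : t g = alpha (halve g) (t 0).
Proof. by rewrite alpha_t add0r halveK. Qed.
Let t'_0 g : t' g = alpha (halve g) (t' 0).
Proof. by rewrite alpha_t' add0r halveK. Qed.
Let alphaM g x y : alpha g (x * y) = alpha g x * alpha g y.
Proof. exact: rmorphM. Qed.
Let alphaZ g c x : alpha g (c *: x) = c *: alpha g x.
Proof. exact: linearZ. Qed.
Let rho_t_0 g : rho (t g) = alpha (- halve g) (rho (t 0)).
Proof. by rewrite t_0 (fs_alpha_rho sys) opprK. Qed.
Let halveN (g : G) : (- halve g) *+ 2 = - g.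
Proof. by rewrite mulNrn halveK. Qed.

(** Applying [alpha (- halve g)] reduces everything about [rho (t g)] to [rho (t 0)]; hence [M]
    depends only on [h + g] and [l + g]. Similarly [alpha (halve g)] handles [b] and [b']. *)
Lemma constants : exists (a a' b b' B C : F) (M : G -> G -> F),
  [/\ s' * rho s = a%:A /\ (forall g, t' g * rho s = b *: t g),
      rho s' * s = a'%:A /\ (forall g, rho s' * t g = b' *: t' g),
      forall g, s' * rho (t g) = B *: t' (- g),
      forall h g, t' h * rho (t g) * s = (C *+ (h == - g)) *: s &
      forall h g l,
        t' h * rho (t g) * t l = M (h + g) (l + g) *: t (h + l + g)].
Proof.
have [a Ea] := s'_rho_s sys; have [b Eb] := t'_rho_s sys 0.
have [a' Ea'] := rho_s'_s sys; have [b' Eb'] := rho_s'_t sys 0.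
have [B EB] := s'_rho_t sys 0; have [C EC] := t'_rho_t_s sys 0 0.
have [M EM] := choice (fun p : G * G => t'_rho_t_t sys p.1 0 p.2).
exists a, a', b, b', B, C, (fun h l => M (h, l)).
have as_ h := alpha_s sys odd_G h.
split; [split=> // g|split=> // g|move=> g|move=> h g|move=> h g l].
- rewrite t'_0 t_0 -alphaZ -Eb alphaM (fs_alpha_rho sys (halve g) s).
  by rewrite as_.
- rewrite t'_0 t_0 -alphaZ -Eb' alphaM (fs_alpha_rho sys (halve g) s').
  by rewrite alpha_s'.
- rewrite rho_t_0 -{1}(alpha_s' (- halve g)) -alphaM EB alphaZ alpha_t'.
  by rewrite halveN oppr0 add0r.
- have -> : t' h = alpha (- halve g) (t' (h + g)) by rewrite alpha_t' halveN addrK.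
  rewrite rho_t_0 -{1}(as_ (- halve g)) -!alphaM.
  have [E|ne] := eqVneq h (- g).
    rewrite E addNr EC oppr0 eqxx alphaZ as_ //.
  have [c ->] := t'_rho_t_s sys (h + g) 0.
  by rewrite oppr0 addr_eq0 (negPf ne) alphaZ !scale0r.
- have -> : t' h = alpha (- halve g) (t' (h + g)) by rewrite alpha_t' halveN addrK.
  have -> : t l = alpha (- halve g) (t (l + g)) by rewrite alpha_t halveN addrK.
  rewrite rho_t_0 -!alphaM (EM (h + g, l + g)) alphaZ /= alpha_t halveN.
  by congr (_ *: t _); zmod.
Qed.

End Normalization.

(** * Identification of the constants over the complex numbers, and assembly *)

Lemma conj_cube_root (C : numClosedFieldType) (w : C) : w ^+ 3 = 1 -> w^* = w^-1.
Proof.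
move=> w3; have nw : `|w| = 1.
  apply/eqP; rewrite -(@pexpr_eq1 _ _ 3) ?normr_ge0 //.
  by rewrite -normrX w3 normr1.
by rewrite invC_norm nw expr1n invr1 mul1r.
Qed.

(** Completing the square for 1/a, a root of x^2 - nu x - 1, shows that 2/a - nu is a square root of
    nu^2 + 4. *)
Lemma delta_pm_inv (R : realType) (nu : nat) (a : R[i]) :
  a ^+ 2 + nu%:R * a = 1 -> exists minus, a = (delta_pm R nu minus)^-1.
Proof.
move=> Ea; have a0 : a != 0.
  by apply: contra_eq_neq Ea => ->; rewrite expr0n mulr0 addr0 eq_sym oner_neq0.
pose r := Num.sqrt (nu%:R ^+ 2 + 4 : R).
have r2 : (r%:C)%C ^+ 2 = nu%:R ^+ 2 + 4.
  rewrite -rmorphXn /= sqr_sqrtr ?addr_ge0 ?sqr_ge0 //.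
  by rewrite rmorphD rmorphXn /= !rmorph_nat.
have : (2 * a^-1 - nu%:R) ^+ 2 == (r%:C)%C ^+ 2.
  rewrite r2 -subr_eq0.
  have -> : (2 * a^-1 - nu%:R) ^+ 2 - (nu%:R ^+ 2 + 4)
    = 4 * a^-1 ^+ 2 * (1 - (a ^+ 2 + nu%:R * a)) by field.
  by rewrite Ea subrr mulr0.
have dE minus : delta_pm R nu minus = (nu%:R + (-1) ^+ minus * (r%:C)%C) / 2.
  by rewrite /delta_pm -/r rmorphM fmorphV rmorphD rmorphM rmorphXn rmorphN1 /= !rmorph_nat.
rewrite eqf_sqr => /orP[]/eqP E; [exists false | exists true];
  rewrite dE -[LHS]invrK; congr (_^-1).
  by rewrite expr0 mul1r -E; field.
by rewrite expr1 mulN1r -E; field.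
Qed.

Lemma sum_option (V : nmodType) (I : finType) (f : option I -> V) :
  \sum_o f o = f None + \sum_i f (Some i).
Proof.
rewrite (bigD1 None) //=; congr (_ + _).
rewrite (reindex_omap (Some : I -> option I) id) /=; last by case.
by apply: eq_bigl => i; rewrite eqxx.
Qed.

Lemma fusion_leavitt (F : fieldType) (G : finZmodType) (A : algType F)
    (alpha : G -> {lrmorphism A -> A}) (rho : {lrmorphism A -> A})
    (s s' : A) (t t' : G -> A) :
  fusion_system alpha rho s s' t t' ->
  leavitt_relations (family_of s t) (family_of s' t').
Proof.
move=> sys; split=> [[g|] [h|]|]; rewrite ?kdelta_alg ?sum_option /=.
- by rewrite (fs_t't sys).
- by rewrite (fs_t's sys).
- by rewrite (fs_s't sys).
- by rewrite (fs_s's sys).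
- by rewrite (fs_sum1 sys).
Qed.

Theorem theorem1 (R : realType) (G : finZmodType) (A : algType R[i])
    (alpha : G -> {lrmorphism A -> A}) (rho : {lrmorphism A -> A})
    (s s' : A) (t t' : G -> A)
    (odd_G : odd #|G|)
    (alpha0 : forall x, alpha 0 x = x)
    (s's : s' * s = 1)
    (s't : forall g, s' * t g = 0)
    (t's : forall g, t' g * s = 0)
    (t't : forall g h, t' g * t h = (kdelta R[i] g h)%:A)
    (sum1 : s * s' + \sum_g t g * t' g = 1)
    (alphaD : forall g h x, alpha g (alpha h x) = alpha (g + h) x)
    (alpha_rho : forall g x, alpha g (rho x) = rho (alpha (- g) x))
    (rho_rho : forall x,
       rho (rho x) = s * x * s' + \sum_g t g * alpha g (rho x) * t' g)
    (simple : all_simple (fun g => alpha g : A -> A) rho) :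
  exists (c : R[i]) (d : G -> R[i]),
    [/\ c != 0, forall g, d g != 0 &
    let S := c *: s in
    let S' := c^-1 *: s' in
    let T := fun g => d g *: t g in
    let T' := fun g => (d g)^-1 *: t' g in
    exists (minus : bool) (omega b : R[i]) (a : G -> G -> R[i]),
    let delta := delta_pm R #|G| minus in
    [/\ omega ^+ 3 = 1 /\ b ^+ 2 = (omega * delta)^-1,
        [/\ rho S = delta^-1 *: S + b *: \sum_k T k * T k,
            rho S' = delta^-1 *: S' + (omega * b) *: \sum_k T' k * T' k,
            forall g : G, rho (T g) =
              b *: (S * T' (- g)) + omega *: (T (- g) * S * S')
              + \sum_(l : G) \sum_(k : G)
                  a (l + g) (k + g) *: (T l * T (l + k + g) * T' k) &
            forall g : G, rho (T' g) =
              (omega * b) *: (T (- g) * S') + omega^* *: (S * S' * T' (- g))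
              + \sum_(l : G) \sum_(k : G)
                  a (k + g) (l + g) *: (T k * T' (g + l + k) * T' l)],
        [/\ forall g, alpha g S = S,
            forall g, alpha g S' = S',
            forall g h, alpha g (T h) = T (h + g *+ 2) &
            forall g h, alpha g (T' h) = T' (h + g *+ 2)],
        restrict_to_leavitt (fun g => alpha g : A -> A) rho S S' T T' &
        [/\ forall g h : G, a g h = omega * a (- h) (g - h) /\
                        a g h = omega^* * a (h - g) (- g),
            \sum_h a h 0 = - (omega^* * delta^-1),
            forall h k : G, \sum_(g : G) a (h + g) k * a k g =
              kdelta R[i] h 0 - delta^-1 * kdelta R[i] k 0 &
            forall g h i k : G,
              \sum_(l : G) \sum_(m : G)
                a l m * a (l + g) h * a (h + m) (l + i) * a i (k + m) =
              a (h - g) (i - g) * kdelta R[i] k g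
              - omega^* * delta^-1 * kdelta R[i] h 0 * a i k
              - omega * delta^-1 * a g h * kdelta R[i] i 0]]].
Proof.
have hom := all_simple_hom simple.
have sys0 : fusion_system alpha rho s s' t t'.
  split=> //; try by move=> g h; case: (hom g h).
  by move=> g h; rewrite t't kdelta_alg.
have [d d0 alpha_t] := normalize sys0 odd_G.
have sys1 := rescale_t sys0 d0.
have [a [a' [b [b' [B [C [M [[Ea Eb] [Ea' Eb'] EB EC EM]]]]]]]] :=
  constants sys1 odd_G alpha_t.
have alpha_s1 := alpha_s sys1 odd_G.
have alpha_s'1 := alpha_s' sys1 odd_G alpha_t.
have alpha_t'1 := alpha_t' sys1 alpha_t.
have b_n0 := b_neq0 sys1 alpha_s1 Ea Eb EB EC.
have B_n0 := B_neq0 sys1 alpha_s1 Ea Eb EB EC.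
(* Scaling [s] by [c] replaces b by c b and B by B / c; this choice of [c] makes them equal, with
   common value [beta]. *)
pose c := sqrtC (B / b).
have c2 : c ^+ 2 = B / b by rewrite sqrtCK.
have c0 : c != 0.
  by apply: contra_neq (mulf_neq0 B_n0 (invr_neq0 b_n0)) => c0; rewrite -c2 c0 expr0n.
exists c, d; split=> // S S' T T'.
have sys2 := rescale_s sys1 c0.
have [minus Eminus] := delta_pm_inv (a_quadratic sys1 alpha_s1 Ea Eb EB EC).
have rhoZ k x : rho (k *: x) = k *: rho x by exact: linearZ.
have alphaZ g k x : alpha g (k *: x) = k *: alpha g x by exact: linearZ.
pose beta := c * b.
have BE : c^-1 * B = beta.
  have -> : B = c ^+ 2 * b by rewrite c2 divfK.
  by rewrite /beta expr2 -mulrA mulKf.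
have alpha_S h : alpha h S = S by rewrite alphaZ alpha_s1.
have alpha_S' h : alpha h S' = S' by rewrite alphaZ alpha_s'1.
have alpha_T h g : alpha h (T g) = T (g + h *+ 2) by exact: alpha_t.
have alpha_T' h g : alpha h (T' g) = T' (g + h *+ 2) by exact: alpha_t'1.
have Ea2 : S' * rho S = a%:A.
  by rewrite rhoZ -scalerAl -scalerAr scalerA mulVf // scale1r.
have Eb2 g : T' g * rho S = beta *: T g by rewrite rhoZ -scalerAr Eb [LHS]scalerA.
have Ea'2 : rho S' * S = a'%:A.
  by rewrite rhoZ -scalerAl -scalerAr scalerA mulVf // scale1r.
have Eb'2 g : rho S' * T g = (c^-1 * b') *: T' g by rewrite rhoZ -scalerAl Eb' [LHS]scalerA.
have EB2 g : S' * rho (T g) = beta *: T' (- g) by rewrite -scalerAl EB [LHS]scalerA BE.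
have EC2 h g : T' h * rho (T g) * S = (C *+ (h == - g)) *: S.
  by rewrite -scalerAr EC !scalerA mulrC.
have C3 := C_cube sys2 alpha_S alpha_S' alpha_t Ea2 Eb2 Ea'2 Eb'2 EB2 EC2.
have Cconj := conj_cube_root C3.
have a'E := a'_eq sys2 alpha_S Ea2 Eb2 Ea'2 EB2 EC2.
have b'E := b'_eq sys2 alpha_S alpha_S' Ea2 Eb2 Ea'2 Eb'2 EB2 EC2.
have aE := bBC sys2 alpha_S Ea2 Eb2 EB2 EC2.
have C_n0 := C_neq0 sys2 alpha_S Ea2 Eb2 EB2 EC2.
exists minus, C, beta, M => delta.
have deltaE : delta^-1 = a by rewrite Eminus.
have rhoS := rho_sE sys2 Ea2 Eb2.
have rhoS' := rho_s'E sys2 Ea'2 Eb'2.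
have rhoT := rho_tE sys2 EB2 EC2 EM.
have rhoT' := rho_t'E sys2 alpha_S alpha_S' alpha_t Ea2 Eb2 Ea'2 Eb'2 EB2 EC2 EM.
have rot := rotation_M sys2 alpha_S alpha_S' alpha_t Ea2 Eb2 Ea'2 Eb'2 EB2 EC2 EM.
rewrite b'E a'E in rhoS'.
rewrite Cconj invfM deltaE; split.
(* For the rescaled constants [bBC] reads beta^2 C = a. *)
- by split=> //; rewrite -aE expr2 [RHS]mulrC mulfK.
- by split.
- by split.
- pose X := (range (family_of S T) `|` range (family_of S' T'))%classic.
  have XS : subalg_gen X S by apply: subalg_gen_in; left; exists None.
  have XS' : subalg_gen X S' by apply: subalg_gen_in; right; exists None.
  have XT g : subalg_gen X (T g) by apply: subalg_gen_in; left; exists (Some g).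
  have XT' g : subalg_gen X (T' g) by apply: subalg_gen_in; right; exists (Some g).
  have XZ := @subalg_gen_scale _ _ X; have XD := @subalg_gen_add _ _ X.
  have XM := @subalg_gen_mul _ _ X; have Xsum := @subalg_gen_sum _ _ X.
  apply: (restrict_to_leavitt_subalg 0 (fusion_leavitt sys2)); rewrite -/X.
  + by move=> g [h|] /=; rewrite ?alpha_S ?alpha_T.
  + by move=> g [h|] /=; rewrite ?alpha_S' ?alpha_T'.
  + move=> [g|] /=; [rewrite rhoT | rewrite rhoS].
      apply: (XD); first apply: (XD); first 2 last.
      * apply: (Xsum) => l; apply: (Xsum) => k; apply: (XZ).
        by apply: (XM) (XT' k); apply: (XM); apply: XT.
      * by apply: (XZ); apply: (XM) (XT' _).
      * by apply: (XZ); apply: (XM) (XS'); apply: (XM) (XS); apply: XT.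
    by apply: (XD); apply: (XZ) => //; apply: (Xsum) => k; apply: (XM); apply: XT.
  + move=> [g|] /=; [rewrite rhoT' | rewrite rhoS'].
      apply: (XD); first apply: (XD); first 2 last.
      * apply: (Xsum) => l; apply: (Xsum) => k; apply: (XZ).
        by apply: (XM) (XT' l); apply: (XM) (XT' _); apply: XT.
      * by apply: (XZ); apply: (XM) (XS'); apply: XT.
      * by apply: (XZ); apply: (XM) (XT' _); apply: (XM).
    by apply: (XD); apply: (XZ) => //; apply: (Xsum) => k; apply: (XM); apply: XT'.
- split.
  + move=> g h; split; first exact: rot.
    (* The second symmetry is the first applied twice, with C^2 = C^-1. *)
    rewrite rot rot opprB addrA mulrA -expr2.
    have -> : C ^+ 2 = C^-1 by apply: (mulIf C_n0); rewrite -exprSr C3 mulVf.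
    by congr (_ * M _ _); zmod.
  + exact: (sum_M_0 sys2 alpha_S Ea2 Eb2 EB2 EC2 EM).
  + exact: (quadratic_M sys2 alpha_S Ea2 Eb2 EB2 EC2 EM).
  + exact: (quartic_M sys2 alpha_S alpha_S' alpha_t Ea2 Eb2 Ea'2 Eb'2 EB2 EC2 EM).
Qed.
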